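(* Let $\mathcal{Z}$ be a mixing shift of finite type with left shift $\sigma$. Let $\Theta$ be a compact metric space, $\{f_\theta:\theta\in\Theta\}$ a regular family of Hölder potentials on $\mathcal{Z}$, and $\mu_\theta$ the Gibbs measure of $f_\theta$. Let $\Pi_0$ be a fully supported Borel probability measure on $\Theta$, and let $\theta^*\in\Theta$. Let $\mathbf{Y}=(Y_k)_{k\in\mathbb{Z}}$ be distributed according to $\mu_{\theta^*}$. For each $n$ define the posterior \[ \Pi_n(A\mid y_0^{n-1})=\frac{\int_A\mu_\theta([y_0^{n-1}])\,d\Pi_0(\theta)}{\int_\Theta\mu_\theta([y_0^{n-1}])\,d\Pi_0(\theta)}, \] where $[y_0^{n-1}]=\{z\in\mathcal{Z}:z_0^{n-1}=y_0^{n-1}\}$. Let $[\theta^*]=\{\theta\in\Theta:\mu_\theta=\mu_{\theta^*}\}$. Then for every open $U\subset\Theta$ containing $[\theta^*]$, with $\mu_{\theta^*}$-probability one, \[ \lim_{n\to\infty}\Pi_n(\Theta\setminus U\mid Y_0^{n-1})=0. \]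
   Context: A mixing shift of finite type $\mathcal{Z}\subset\mathcal{A}^{\mathbb{Z}}$ ($\mathcal{A}$ finite) is the set of sequences avoiding a fixed finite set of forbidden words, such that for any two words $u,v$ occurring in $\mathcal{Z}$ there is $N$ so that for each $m\ge N$ some word $w$ of length $m$ makes $uwv$ occur in $\mathcal{Z}$. The shift is $(\sigma z)_i=z_{i+1}$ and the metric is $d(x,y)=2^{-n(x,y)}$ with $n(x,y)=\inf\{|m|:x_m\ne y_m\}$. $C^r(\mathcal{Z})$ is the space of $r$-Hölder functions with norm $\|f\|_r=\sup|f|+\sup_{x\neq y}|f(x)-f(y)|/d(x,y)^r$. A family $\{f_\theta\}$ is regular if for some $r>0$ all $f_\theta\in C^r(\mathcal{Z})$ and $\theta\mapsto f_\theta$ is continuous in $\|\cdot\|_r$. The Gibbs measure $\mu_\theta$ is the unique $\sigma$-invariant Borel probability measure for which there are constants $K>0$ and $\mathcal{P}(f_\theta)$ (the pressure) with \[ K^{-1}\le\mu_\theta(x[0,m-1])\big/\exp\bigl(-m\mathcal{P}(f_\theta)+\textstyle\sum_{k<m}f_\theta(\sigma^kx)\bigr)\le K \] for all $x\in\mathcal{Z}$ and $m\ge1$, where $x[0,m-1]$ is the cylinder of points agreeing with $x$ on coordinates $0,\dots,m-1$. *)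

(* Defs.v *)
From HB Require Import structures.
From mathcomp Require Import all_boot all_order all_algebra.
From mathcomp Require Import all_classical all_reals all_analysis.
Set Implicit Arguments. Unset Strict Implicit. Unset Printing Implicit Defensive.
Import Order.TTheory GRing.Theory Num.Theory.
Import numFieldNormedType.Exports.
Local Open Scope classical_set_scope.
Local Open Scope ring_scope.

HB.structure Definition FinPointed := {T of Finite T & isPointed T}.
Notation finPointedType := FinPointed.type.

Section Defs.
Variable A : finPointedType.

Definition seqZ := int -> A.

Definition word_at (z : seqZ) (i : int) (m : nat) : seq A :=
  [seq z (i + k%:Z) | k <- iota 0 m].

Definition SFT (F : seq (seq A)) : set seqZ :=
  [set z | forall (i : int) (w : seq A), w \in F -> word_at z i (size w) != w].

Definition occurs (Z : set seqZ) (u : seq A) : Prop :=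
  exists z i, Z z /\ word_at z i (size u) = u.

Definition mixing (Z : set seqZ) : Prop :=
  forall u v, occurs Z u -> occurs Z v ->
    exists N : nat, forall m : nat, (N <= m)%N ->
      exists w : seq A, size w = m /\ occurs Z (u ++ w ++ v).

Definition shift (x : seqZ) : seqZ := fun i => x (i + 1).

Definition cylinders : set (set seqZ) :=
  [set C | exists (x : seqZ) (i : int) (m : nat),
     C = [set z | word_at z i m = word_at x i m]].

(* the sequence space with the product (= Borel) sigma-algebra *)
Local Notation seqM := (g_sigma_algebraType cylinders).

Definition cyl (x : seqZ) (m : nat) : set seqZ :=
  [set z | word_at z 0 m = word_at x 0 m].

Definition diffat (x y : seqZ) (n : nat) : bool :=
  (x n%:Z != y n%:Z) || (x (- n%:Z) != y (- n%:Z)).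

Variable R : realType.

Definition dist (x y : seqZ) : R :=
  match pselect (exists n, diffat x y n) with
  | left h => (2%:R)^-1 ^+ (ex_minn h)
  | right _ => 0
  end.

(* Hoelder norm ||g||_r on Z (value in extended reals); sups of nonnegative
   quantities, so sup of the empty set is taken as 0 *)
Definition hnorm (r : R) (Z : set seqZ) (g : seqZ -> R) : \bar R :=
  (ereal_sup ([set 0%E] `|` [set (`|g x|)%:E | x in Z]) +
   ereal_sup ([set 0%E] `|` [set (`|g p.1 - g p.2| / powR (dist p.1 p.2) r)%:E
              | p in [set p : seqZ * seqZ | Z p.1 /\ Z p.2 /\ p.1 <> p.2]]))%E.

Definition hoelder (r : R) (Z : set seqZ) (g : seqZ -> R) : Prop :=
  (hnorm r Z g < +oo)%E.

Definition regular_family (Th : pseudoMetricType R) (Z : set seqZ)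
  (f : Th -> seqZ -> R) : Prop :=
  exists r : R, 0 < r /\ (forall t, hoelder r Z (f t)) /\
    forall t (e : R), 0 < e ->
      \forall t' \near t, (hnorm r Z (fun x => (f t' x - f t x)%R) < e%:E)%E.

Definition gibbs (Z : set seqZ) (g : seqZ -> R) (mu : probability seqM R) : Prop :=
  (mu Z = 1%E) /\
  (forall S : set seqM, measurable S -> mu (shift @^-1` S) = mu S) /\
  exists (K P : R), 0 < K /\
    forall x : seqZ, Z x -> forall m : nat, (1 <= m)%N ->
      let q := fine (mu (cyl x m)) /
               expR (- (m%:R * P) + \sum_(k < m) g (iter k shift x)) in
      K^-1 <= q /\ q <= K.

End Defs.

Notation seqM A := (g_sigma_algebraType (@cylinders A)).

Notation borelM T := (@g_sigma_algebraType (T : pointedType) (@open T)).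

Definition posterior (A : finPointedType) (R : realType) (Th : pseudoPMetricType R)
  (Pi0 : probability (borelM Th) R) (mu : Th -> probability (seqM A) R)
  (n : nat) (B : set Th) (y : seqZ A) : R :=
  fine (\int[Pi0]_(t in (B : set (borelM Th))) mu t (cyl y n))%E /
  fine (\int[Pi0]_(t in [set: borelM Th]) mu t (cyl y n))%E.

(* Main.v *)
(** A fully finitary argument on words replaces thermodynamic formalism and the ergodic
    theorem. A Gibbs measure gives a word [w] a mass [p w] comparable to the explicit weight
    [G w = exp (S_n f - n P)], and mixing makes [G] multiplicative up to a constant [D] across
    a gap of fixed length [N]. Counting the occurrences of [w] in many disjoint blocks, with
    an exponential moment, bounds [p w / G w] by constants depending on [D] only, hence
    locally uniformly in the parameter. The affinity [sum sqrt (G0 G1)] over words of length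
    [n] is submultiplicative up to the gap, so it either stays above [1 / D], in which case
    [G1 <= C G0] and the two measures coincide, or decays exponentially. In the latter case
    Markov's inequality and Borel-Cantelli give an almost sure exponential decay of the
    likelihood ratio, uniformly near the parameter; compactness of the complement of [U]
    controls the numerator of the posterior, and a small neighbourhood of [tstar], of
    positive prior mass, its denominator. *)

Require Import Defs.
From HB Require Import structures.
From mathcomp Require Import all_boot all_order all_algebra.
From mathcomp Require Import all_classical all_reals all_analysis.
From mathcomp Require Import ring lra zify.
Set Implicit Arguments. Unset Strict Implicit. Unset Printing Implicit Defensive.
Import Order.TTheory GRing.Theory Num.Theory.
Import numFieldNormedType.Exports.
Local Open Scope classical_set_scope.
Local Open Scope ring_scope.

(** * Bounded powers and the Cauchy-Schwarz inequality for finite sums *)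

Section BoundedPowers.
Variable R : realType.
Implicit Types x C : R.

(** By Bernoulli's inequality the powers of a base above one outgrow any bound. This is how a
    constant attached to a single measure is discarded below: it survives only as a bound on all
    [n]-th powers. *)
Lemma bounded_exp_le1 x C : 0 <= x -> (forall n, x ^+ n <= C) -> x <= 1.
Proof.
move=> x0 xC; rewrite leNgt; apply/negP => x1.
have bern n : 1 + n%:R * (x - 1) <= x ^+ n.
  elim: n => [|n IH]; first by rewrite mul0r addr0 expr0.
  rewrite exprS -natr1.
  have /(ler_wpM2l x0) := IH; apply: le_trans.
  have : (0 : R) <= n%:R by [].
  by move: (n%:R : R) => t t0; have := mulr_ge0 t0 (sqr_ge0 (x - 1)); nra.
have h0 : 0 < x - 1 by rewrite subr_gt0.
pose n := Num.bound (`|C| / (x - 1)).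
have : `|C| / (x - 1) < n%:R by apply: archi_boundP; apply: divr_ge0 => //; exact: ltW.
rewrite ltr_pdivrMr // => hn.
have := le_trans (bern n) (xC n); have := ler_norm C; lra.
Qed.

Lemma exp_bounded_below_ge1 x C :
  0 <= x -> 0 < C -> (forall n, C <= x ^+ n) -> 1 <= x.
Proof.
move=> x0 C0 xC.
have {}x0 : 0 < x.
  by rewrite lt_neqAle x0 andbT eq_sym; apply/eqP => xz; have := xC 1%N; rewrite xz expr1; lra.
rewrite -(invf_le1 x0); apply: (@bounded_exp_le1 _ C^-1) => [|n].
  by rewrite invr_ge0 ltW.
by rewrite exprVn lef_pV2 // posrE exprn_gt0.
Qed.

Lemma bounded_expR_le0 x C : (forall n, expR (n%:R * x) <= C) -> x <= 0.
Proof.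
move=> xC; rewrite -[x <= 0]ler_expR expR0.
apply: (@bounded_exp_le1 _ C) => [|n]; first exact: expR_ge0.
by rewrite -expRM_natl.
Qed.

Lemma sum_sqrt_le (I : Type) (s : seq I) (F G : I -> R) :
  (forall i, 0 <= F i) -> (forall i, 0 <= G i) ->
  \sum_(i <- s) Num.sqrt (F i * G i) <=
  Num.sqrt ((\sum_(i <- s) F i) * \sum_(i <- s) G i).
Proof.
move=> F0 G0; elim: s => [|i s IH]; first by rewrite !big_nil mul0r sqrtr0.
rewrite !big_cons; apply: le_trans (lerD (lexx _) IH) _.
have Fs : 0 <= \sum_(i <- s) F i by exact: sumr_ge0.
have Gs : 0 <= \sum_(i <- s) G i by exact: sumr_ge0.
have Fi := F0 i; have Gi := G0 i.
move: (F i) (G i) (\sum_(i <- s) F i) (\sum_(i <- s) G i) Fs Gs Fi Gi => a b X Y X0 Y0 a0 b0.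
rewrite (sqrtrM _ a0) (sqrtrM _ X0).
rewrite -[leLHS]ger0_norm ?addr_ge0 ?mulr_ge0 ?sqrtr_ge0 //.
rewrite -sqrtr_sqr ler_wsqrtr //.
rewrite -{2}(sqr_sqrtr a0) -{2}(sqr_sqrtr b0) -{2}(sqr_sqrtr X0) -{2}(sqr_sqrtr Y0).
move: (Num.sqrt a) (Num.sqrt b) (Num.sqrt X) (Num.sqrt Y) => u v x y.
have := sqr_ge0 (u * y - v * x); nra.
Qed.

End BoundedPowers.

(** * Words of fixed length and weights quasi-multiplicative across a gap *)

Section Words.
Variable A : finType.
Implicit Types u v w : seq A.

Fixpoint words n : seq (seq A) :=
  if n is m.+1 then [seq a :: u | a <- enum A, u <- words m] else [:: [::]].

Lemma mem_words n u : (u \in words n) = (size u == n).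
Proof.
elim: n u => [|n IH] u /=; first by rewrite inE size_eq0.
apply/allpairsP/eqP => [[[a v] /= [_ vn ->]]|].
  by move: vn => /=; rewrite IH => /eqP ->.
case: u => // a v [sv]; exists (a, v); split => //=; first by rewrite mem_enum.
by rewrite IH sv.
Qed.

Lemma uniq_words n : uniq (words n).
Proof.
elim: n => //= n IH; apply: allpairs_uniq => //; first exact: enum_uniq.
by move=> [a u] [b v] _ _ /= [-> ->].
Qed.

Lemma size_words n : size (words n) = (#|A| ^ n)%N.
Proof. by elim: n => //= n IH; rewrite size_allpairs -cardE IH expnS. Qed.

Variable R : realType.

Lemma sum_words_cat m n (g : seq A -> R) :
  \sum_(u <- words (m + n)) g u =
  \sum_(u <- words m) \sum_(v <- words n) g (u ++ v).
Proof.
elim: m g => [|m IH] g; first by rewrite big_seq1.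
rewrite addSn /= !big_allpairs_dep; apply: eq_bigr => a _.
exact: (IH (fun u => g (a :: u))).
Qed.

Lemma sum_words_pred1 n w (g : seq A -> R) : size w = n ->
  \sum_(u <- words n) (u == w)%:R * g u = g w.
Proof.
move=> sw; rewrite (bigD1_seq w) ?uniq_words ?mem_words ?sw //= eqxx mul1r.
by rewrite big1 ?addr0 // => u /negbTE ->; rewrite mul0r.
Qed.

Definition wsum (G : seq A -> R) n : R := \sum_(u <- words n) G u.

(** Multiplicativity is asked only after summing over the fillings of a gap of length [N], since
    [a ++ b] itself may be a word that never occurs. *)
Definition gapquasi (N : nat) (D : R) (G : seq A -> R) : Prop :=
  [/\ 1 <= D, (forall w, 0 <= G w),
      (forall a b, G a * G b <= D * \sum_(x <- words N) G (a ++ x ++ b)) &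
      (forall a b, \sum_(x <- words N) G (a ++ x ++ b) <= D * (G a * G b))].

Lemma wsum_gap (G : seq A -> R) m N n : wsum G (m + (N + n)) =
  \sum_(a <- words m) \sum_(b <- words n) \sum_(x <- words N) G (a ++ x ++ b).
Proof.
rewrite /wsum sum_words_cat; apply: eq_bigr => a _.
by rewrite sum_words_cat exchange_big.
Qed.

Lemma gapquasi_wsum_gap N D G m n : gapquasi N D G ->
  (wsum G m * wsum G n <= D * wsum G (m + (N + n))) /\
  (wsum G (m + (N + n)) <= D * (wsum G m * wsum G n)).
Proof.
move=> [D1 G0 Gl Gu]; rewrite wsum_gap /wsum big_distrl /=; split.
  rewrite big_distrr /=; apply: ler_sum => a _.
  by rewrite !big_distrr /=; apply: ler_sum => b _; exact: Gl.
rewrite big_distrr; apply: ler_sum => a _.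
by rewrite !big_distrr /=; apply: ler_sum => b _; exact: Gu.
Qed.

Lemma wsum_ge0 G n : (forall w, 0 <= G w) -> 0 <= wsum G n.
Proof. by move=> G0; apply: sumr_ge0. Qed.

(** The gap inequalities, iterated along [j + 1] stretches of length [n] separated by gaps (total
    length [t j]), compare [wsum G (t j)] with powers of [wsum G n / D] and of [wsum G n * D].
    Boundedness of these powers leaves only [D]. *)
Lemma gapquasi_wsum_bounds N D G K : gapquasi N D G -> 0 < K ->
  (forall n, K^-1 <= wsum G n <= K) -> forall n, D^-1 <= wsum G n <= D.
Proof.
move=> GQ K0 sK n; have [D1 G0 _ _] := GQ.
have D0 : 0 < D by lra.
pose t := fix t j := if j is i.+1 then (n + (N + t i))%N else n.
have sn0 : 0 < wsum G n.
  by have /andP[+ _] := sK n; apply: lt_le_trans; rewrite invr_gt0.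
have KM1 : K * K^-1 = 1 by rewrite mulfV ?lt0r_neq0.
have Kn0 : 0 < K^-1 by rewrite invr_gt0.
have tl j : (wsum G n / D) ^+ j * wsum G n <= wsum G (t j).
  elim: j => [|j IH]; first by rewrite expr0 mul1r.
  rewrite exprS -mulrA mulrAC ler_pdivrMr //= [leRHS]mulrC.
  have [+ _] := gapquasi_wsum_gap n (t j) GQ; apply: le_trans.
  by rewrite ler_wpM2l // ltW.
have tu j : wsum G (t j) <= (wsum G n * D) ^+ j * wsum G n.
  elim: j => [|j IH]; first by rewrite expr0 mul1r.
  have [_ /le_trans] := gapquasi_wsum_gap n (t j) GQ; apply.
  have Ds0 : 0 <= D * wsum G n by rewrite mulr_ge0 // ltW.
  have := ler_wpM2l Ds0 IH; rewrite mulrA => /le_trans; apply.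
  by rewrite exprS le_eqVlt; apply/orP; left; apply/eqP; ring.
apply/andP; split.
  rewrite -(ler_pM2r D0) mulVf ?lt0r_neq0 //.
  (* One factor [K^-1] bounds [wsum G (t j)] from below, the other absorbs the extra factor
     [wsum G n] in [tu]. *)
  apply: (@exp_bounded_below_ge1 _ _ (K^-1 * K^-1)) => [||j].
  - by rewrite mulr_ge0 // ltW.
  - by rewrite mulr_gt0.
  have /andP[sl _] := sK (t j); have := le_trans sl (tu j) => h.
  have /andP[_ su] := sK n.
  have q0 : 0 <= (wsum G n * D) ^+ j by rewrite exprn_ge0 // mulr_ge0 // ltW.
  have /(ler_wpM2l (ltW Kn0)) := le_trans h (ler_wpM2l q0 su).
  by move/le_trans; apply; rewrite mulrCA [K^-1 * K]mulVf ?lt0r_neq0 // mulr1.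
rewrite -[leRHS]mul1r -ler_pdivrMr //.
apply: (@bounded_exp_le1 _ _ (K * K)) => [|j].
  by rewrite divr_ge0 // ltW.
have /andP[_ su] := sK (t j); have h := le_trans (tl j) su.
have /andP[sl _] := sK n.
have q0 : 0 <= (wsum G n / D) ^+ j by rewrite exprn_ge0 // divr_ge0 // ltW.
have := le_trans (ler_wpM2l q0 sl) h.
by rewrite ler_pdivrMr.
Qed.

End Words.

(** * Stationary word families, hit counts and uniform Gibbs bounds *)

Section StationaryWords.
Variables (A : finType) (R : realType).
Implicit Types (p G : seq A -> R) (u v w : seq A).

(** These are the cylinder masses of a shift-invariant probability measure: the sum on the right is
    Kolmogorov consistency, the one on the left adds invariance. *)
Definition stationary p : Prop :=
  [/\ (forall w, 0 <= p w), p [::] = 1,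
      (forall w, \sum_(a : A) p (rcons w a) = p w) &
      (forall w, \sum_(a : A) p (a :: w) = p w)].

Lemma stationary_sum_catr p n w : stationary p ->
  \sum_(u <- words A n) p (w ++ u) = p w.
Proof.
move=> [_ _ pr _]; elim: n w => [|n IH] w /=; first by rewrite big_seq1 cats0.
rewrite big_allpairs_dep big_enum -[RHS]pr; apply: eq_bigr => a _.
by rewrite -IH; apply: eq_bigr => u _; rewrite cat_rcons.
Qed.

Lemma stationary_sum_catl p n w : stationary p ->
  \sum_(u <- words A n) p (u ++ w) = p w.
Proof.
move=> [_ _ _ pl]; elim: n => [|n IH] /=; first by rewrite big_seq1.
rewrite big_allpairs_dep exchange_big -[RHS]IH; apply: eq_bigr => u _ /=.
by rewrite big_enum pl.
Qed.

Lemma stationary_wsum p n : stationary p -> wsum p n = 1.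
Proof. by move=> ps; rewrite /wsum (stationary_sum_catr n [::] ps); case: ps. Qed.

Section Hits.
Variables (N : nat) (w : seq A).

(* A block has length [N + size w + N]; it is hit when [w] sits in its middle. *)
Definition blk : nat := (N + (size w + N))%N.

Definition hit v : bool := take (size w) (drop N v) == w.

Fixpoint hits j u : nat :=
  if j is i.+1 then (hit u + hits i (drop blk u))%N else 0%N.

Lemma hit_cat v u : size v = blk -> hit (v ++ u) = hit v.
Proof.
move=> sv; have lt : (N <= size v)%N by rewrite sv leq_addr.
(* A block can end before its middle begins only if [w] is empty, and then every word is hit. *)
rewrite /hit drop_cat; case: ltnP => h; last first.
  have sw : size w = 0%N by move: sv h; rewrite /blk; lia.
  by rewrite sw !take0.
by rewrite takel_cat // size_drop sv /blk; lia.
Qed.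

Lemma hits_cat j v u : size v = blk -> hits j.+1 (v ++ u) = (hit v + hits j u)%N.
Proof. by move=> sv /=; rewrite hit_cat // drop_size_cat. Qed.

Lemma sum_hit_words (g : seq A -> R) :
  \sum_(v <- words A blk) (hit v)%:R * g v =
  \sum_(x <- words A N) \sum_(z <- words A N) g (x ++ w ++ z).
Proof.
rewrite /blk sum_words_cat; apply: eq_big_seq => x; rewrite mem_words => /eqP sx.
rewrite sum_words_cat -[RHS](@sum_words_pred1 _ _ (size w) w
  (fun y => \sum_(z <- words A N) g (x ++ y ++ z)))//.
apply: eq_big_seq => y; rewrite mem_words => /eqP sy.
rewrite big_distrr; apply: eq_bigr => z _ /=.
by rewrite /hit drop_size_cat // take_size_cat.
Qed.

(** Linearity of expectation: stationarity gives each of the [j] blocks the probability [p w] of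
    being hit, whatever the dependence between blocks. *)
Lemma stationary_sum_hits p j : stationary p ->
  \sum_(u <- words A (j * blk)) p u * (hits j u)%:R = j%:R * p w.
Proof.
move=> ps; elim: j => [|j IH].
  by rewrite mul0r big1 // => u _; rewrite mulr0.
rewrite mulSn sum_words_cat.
transitivity (\sum_(v <- words A blk) ((hit v)%:R * p v +
    \sum_(u <- words A (j * blk)) p (v ++ u) * (hits j u)%:R)).
  apply: eq_big_seq => v; rewrite mem_words => /eqP sv.
  rewrite -(stationary_sum_catr (j * blk) v ps) big_distrr -big_split.
  by apply: eq_bigr => u _; rewrite hits_cat // natrD /=; ring.
rewrite big_split /= sum_hit_words exchange_big /= -natr1 mulrDl mul1r addrC.
congr (_ + _); last first.
  rewrite exchange_big -[RHS](stationary_sum_catl N w ps).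
  by apply: eq_bigr => x _ /=; under eq_bigr do rewrite catA; rewrite stationary_sum_catr.
rewrite -IH exchange_big; apply: eq_bigr => u _ /=.
by rewrite -big_distrl /= stationary_sum_catl.
Qed.

(** Blocks are summed out one at a time. The one-block bound is required in every context because
    the block being summed has words on both sides. *)
Lemma sum_hits_le G (c k : R) j a : 0 <= c -> 0 <= k ->
  (forall a b, \sum_(v <- words A blk) c ^+ hit v * G (a ++ v ++ b) <=
     k * \sum_(v <- words A blk) G (a ++ v ++ b)) ->
  \sum_(u <- words A (j * blk)) c ^+ hits j u * G (a ++ u) <=
  k ^+ j * \sum_(u <- words A (j * blk)) G (a ++ u).
Proof.
move=> c0 k0 step; elim: j a => [|j IH] a.
  by rewrite /= !big_seq1 !expr0.
rewrite mulSn !(@sum_words_cat A R blk).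
apply: (@le_trans _ _ (\sum_(v <- words A blk) c ^+ hit v *
    (k ^+ j * \sum_(u <- words A (j * blk)) G (a ++ v ++ u)))).
  rewrite big_seq [leRHS]big_seq; apply: ler_sum => v; rewrite mem_words => /eqP sv.
  under eq_bigr do rewrite hits_cat // exprD -mulrA catA.
  rewrite -big_distrr ler_wpM2l ?exprn_ge0 //.
  by apply: (le_trans (IH (a ++ v))); under eq_bigr do rewrite -catA.
under eq_bigr do rewrite mulrCA big_distrr.
rewrite -big_distrr exprSr -mulrA ler_wpM2l ?exprn_ge0 //.
rewrite exchange_big [in leRHS]exchange_big big_distrr /=.
by apply: ler_sum => u _; exact: step.
Qed.

End Hits.

Section UniformGibbs.
Variables (N : nat) (D : R) (G : seq A -> R).
Hypothesis GQ : gapquasi N D G.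
Hypothesis wD : forall n, D^-1 <= wsum G n <= D.

Let D1 : 1 <= D. Proof. by case: GQ. Qed.
Let D0 : 0 < D. Proof. exact: lt_le_trans ltr01 D1. Qed.
Let G0 w : 0 <= G w. Proof. by case: GQ. Qed.

Let mid a y b : R :=
  \sum_(x <- words A N) \sum_(z <- words A N) G (a ++ (x ++ y ++ z) ++ b).

(** The two gaps around [y] are closed one after the other, each at the cost of one factor [D]. *)
Let mid_bounds a y b : G a * G y * G b <= D ^+ 2 * mid a y b /\
  mid a y b <= D ^+ 2 * (G a * G y * G b).
Proof.
have [_ _ Gl Gu] := GQ.
have midE : mid a y b =
    \sum_(x <- words A N) \sum_(z <- words A N) G ((a ++ x ++ y) ++ z ++ b).
  by apply: eq_bigr => x _; apply: eq_bigr => z _; rewrite -!catA.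
rewrite midE; split.
  apply: le_trans (ler_wpM2r (G0 b) (Gl a y)) _.
  rewrite expr2 -!mulrA ler_wpM2l ?(ltW D0) // big_distrl big_distrr.
  by apply: ler_sum => x _; exact: Gl.
apply: (@le_trans _ _ (\sum_(x <- words A N) D * (G (a ++ x ++ y) * G b))).
  by apply: ler_sum => x _; exact: Gu.
rewrite -big_distrr expr2 -mulrA ler_wpM2l ?(ltW D0) // -big_distrl /=.
by have := ler_wpM2r (G0 b) (Gu a y); rewrite -!mulrA.
Qed.

Let tot w a b : R := \sum_(v <- words A (blk N w)) G (a ++ v ++ b).

Let totE w a b : tot w a b = \sum_(y <- words A (size w)) mid a y b.
Proof.
rewrite /tot /blk sum_words_cat exchange_big /= sum_words_cat.
apply: eq_bigr => y _; rewrite exchange_big.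
by apply: eq_bigr => x _; apply: eq_bigr => z _; rewrite -!catA.
Qed.

Let tot_bounds w a b : G a * G b <= D ^+ 3 * tot w a b /\
  tot w a b <= D ^+ 3 * (G a * G b).
Proof.
have /andP[sl su] := wD (size w).
have e : \sum_(y <- words A (size w)) G a * G y * G b =
    wsum G (size w) * (G a * G b).
  rewrite /wsum big_distrl; apply: eq_bigr => y _ /=; ring.
have ab0 : 0 <= G a * G b by rewrite mulr_ge0.
split.
  rewrite exprS -mulrA -[leLHS]mul1r -(mulfV (lt0r_neq0 D0)) -mulrA.
  rewrite ler_wpM2l ?(ltW D0) //.
  apply: le_trans (ler_wpM2r ab0 sl) _; rewrite -e totE big_distrr.
  by apply: ler_sum => y _; case: (mid_bounds a y b).
rewrite exprSr -mulrA totE.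
apply: (@le_trans _ _ (D ^+ 2 * (wsum G (size w) * (G a * G b)))); last first.
  by rewrite ler_wpM2l ?exprn_ge0 ?(ltW D0) // ler_wpM2r.
by rewrite -e big_distrr; apply: ler_sum => y _; case: (mid_bounds a y b).
Qed.

(** In any context, the share of the block weight carried by hit blocks is comparable to [G w]. Of
    the five factors [D], two come from [mid_bounds] and three from [tot_bounds]. *)
Let mid_tot w a b : G w * tot w a b <= D ^+ 5 * mid a w b /\
  mid a w b <= D ^+ 5 * G w * tot w a b.
Proof.
have [ml mu] := mid_bounds a w b; have [tl tu] := tot_bounds w a b.
have Dn n : 0 <= D ^+ n by rewrite exprn_ge0 // ltW.
split.
  apply: le_trans (ler_wpM2l (G0 w) tu) _.
  rewrite mulrCA [X in _ * X <= _](_ : _ = G a * G w * G b); last by ring.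
  by rewrite -[5%N]/(3 + 2)%N exprD -(mulrA (D ^+ 3)) ler_wpM2l.
apply: le_trans mu _.
rewrite (_ : G a * G w * G b = G w * (G a * G b)); last by ring.
rewrite (_ : D ^+ 5 * G w * tot w a b = D ^+ 2 * (G w * (D ^+ 3 * tot w a b))); last by ring.
by rewrite !ler_wpM2l.
Qed.

Let sum_hit_weight w a b c :
  \sum_(v <- words A (blk N w)) c ^+ hit N w v * G (a ++ v ++ b) =
  tot w a b + (c - 1) * mid a w b.
Proof.
rewrite /mid -(sum_hit_words N w (fun v => G (a ++ v ++ b))) big_distrr -big_split.
by apply: eq_bigr => v _; case: (hit N w v) => /=; rewrite ?expr0 ?expr1; ring.
Qed.

(** Doubling the hit blocks adds [mid], at most [D ^+ 5 * G w] times the total, and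
    [1 + x <= exp x]. The next lemma takes away half of [mid] in the same way. *)
Lemma sum_hit_double w a b :
  \sum_(v <- words A (blk N w)) 2 ^+ hit N w v * G (a ++ v ++ b) <=
  expR (D ^+ 5 * G w) * \sum_(v <- words A (blk N w)) G (a ++ v ++ b).
Proof.
rewrite sum_hit_weight; have [_ mu] := mid_tot w a b.
have t0 : 0 <= tot w a b by exact: sumr_ge0.
have := ler_wpM2r t0 (expR_ge1Dx (D ^+ 5 * G w)); apply: le_trans.
rewrite mulrDl; lra.
Qed.

Lemma sum_hit_half w a b :
  \sum_(v <- words A (blk N w)) 2^-1 ^+ hit N w v * G (a ++ v ++ b) <=
  expR (- (G w / (2 * D ^+ 5))) * \sum_(v <- words A (blk N w)) G (a ++ v ++ b).
Proof.
rewrite sum_hit_weight; have [ml _] := mid_tot w a b.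
have t0 : 0 <= tot w a b by exact: sumr_ge0.
have := ler_wpM2r t0 (expR_ge1Dx (- (G w / (2 * D ^+ 5)))); apply: le_trans.
have D5 : 0 < D ^+ 5 by rewrite exprn_gt0.
rewrite [leRHS]mulrBl mul1r.
have : G w / (2 * D ^+ 5) * tot w a b <= 2^-1 * mid a w b.
  rewrite invfM mulrA mulrAC ler_pdivrMr // mulrAC.
  nra.
lra.
Qed.

(* Exponential moment of the number of hits: stationarity gives its mean, Jensen a
   lower bound, and the a priori constant [K] disappears in the limit of many blocks. *)
Let hit_frequency p K c k w : stationary p -> (forall u, p u <= K * G u) -> 0 < c ->
  (forall a b, \sum_(v <- words A (blk N w)) c ^+ hit N w v * G (a ++ v ++ b) <=
     expR k * \sum_(v <- words A (blk N w)) G (a ++ v ++ b)) ->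
  ln c * p w <= k.
Proof.
move=> ps pK c0 step; have [p0 _ _ _] := ps.
have K0 : 0 <= K.
  have := pK [::]; have [_ -> _ _] := ps => h; rewrite leNgt; apply/negP => Kn.
  have := mulr_le0_ge0 (ltW Kn) (G0 [::]); lra.
rewrite -subr_le0; apply: (@bounded_expR_le0 _ _ (K * D)) => j.
rewrite mulrBr expRB ler_pdivrMr ?expR_gt0 //.
set m := j%:R * (ln c * p w).
apply: (@le_trans _ _ (\sum_(u <- words A (j * blk N w)) p u * c ^+ hits N w j u)).
  (* The inserted term has mean zero: [m] is exactly the [p]-mean of [ln c] times the number of
     hits. The tangent inequality [1 + x <= exp x] then plays the part of Jensen. *)
  have -> : expR m = expR m * \sum_(u <- words A (j * blk N w))
      p u * (1 + (ln c * (hits N w j u)%:R - m)).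
    under eq_bigr do rewrite addrCA mulrDr mulrCA.
    rewrite big_split /= -big_distrr /= (stationary_sum_hits _ _ _ ps) -big_distrl /=.
    have := stationary_wsum (j * blk N w) ps; rewrite /wsum => ->.
    by rewrite /m; ring.
  rewrite big_distrr; apply: ler_sum => u _ /=.
  rewrite mulrCA ler_wpM2l //.
  apply: le_trans (ler_wpM2l (expR_ge0 m) (expR_ge1Dx _)) _.
  by rewrite -expRD addrC subrK mulrC expRM_natl lnK.
apply: (@le_trans _ _ (\sum_(u <- words A (j * blk N w)) K * (c ^+ hits N w j u * G u))).
  apply: ler_sum => u _; rewrite mulrCA mulrC.
  by rewrite ler_wpM2l ?exprn_ge0 ?(ltW c0).
rewrite -big_distrr -mulrA ler_wpM2l //=.
have := @sum_hits_le N w G c (expR k) j [::] (ltW c0) (expR_ge0 k) step.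
move/le_trans; apply; rewrite expRM_natl mulrC ler_wpM2r ?exprn_ge0 ?expR_ge0 //.
by have /andP[] := wD (j * blk N w).
Qed.

(** [hit_frequency] with [c = 2] bounds [p w] from above, with [c = 1/2] from below, and
    [1/2 <= ln 2 <= 1] tidies the constants. A one-sided comparison with an arbitrary [K] thus
    yields a two-sided one that is free of [K]. *)
Lemma uniform_gibbs p K w : stationary p -> (forall u, p u <= K * G u) ->
  G w <= 2 * D ^+ 5 * p w /\ p w <= 2 * D ^+ 5 * G w.
Proof.
move=> ps pK; have [p0 _ _ _] := ps.
have h2 := hit_frequency ps pK (ltr0n _ 2) (sum_hit_double w).
have half0 : (0 : R) < 2^-1 by rewrite invr_gt0.
have h12 := hit_frequency ps pK half0 (sum_hit_half w).
rewrite lnV ?posrE // mulNr lerN2 in h12.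
have l2u : ln (2 : R) <= 1 by have := @le_ln1Dx R 1 ltac:(lra); rewrite -[1+1]/2.
have l2l : 1 / 2 <= ln (2 : R).
  have := @le_ln1Dx R (- (1 / 2)) ltac:(lra).
  have -> : 1 + - (1 / 2) = 2^-1 :> R by lra.
  by rewrite lnV ?posrE //; lra.
have D5 : 0 < D ^+ 5 by rewrite exprn_gt0.
have pw := p0 w; split; last by nra.
have : G w / (2 * D ^+ 5) <= p w by nra.
by rewrite ler_pdivrMr 1?mulrC // mulr_gt0.
Qed.

End UniformGibbs.
End StationaryWords.

(** * Affinity of two weights: domination, decay and rigidity *)

Section Affinity.
Variables (A : finType) (R : realType) (N : nat) (D : R).
Variables G0 G1 : seq A -> R.
Hypothesis N0 : (0 < N)%N.
Hypotheses (GQ0 : gapquasi N D G0) (GQ1 : gapquasi N D G1).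
Hypothesis wD0 : forall n, D^-1 <= wsum G0 n <= D.
Hypothesis wD1 : forall n, D^-1 <= wsum G1 n <= D.

Let D1 : 1 <= D. Proof. by case: GQ0. Qed.
Let D0 : 0 < D. Proof. exact: lt_le_trans ltr01 D1. Qed.
Let G0_ge0 w : 0 <= G0 w. Proof. by case: GQ0. Qed.
Let G1_ge0 w : 0 <= G1 w. Proof. by case: GQ1. Qed.

(** Summed over words of length [n], this is the Bhattacharyya coefficient of the two weights. *)
Definition affinity (w : seq A) : R := Num.sqrt (G0 w * G1 w).

Let wsum_affinity_le n : wsum affinity n <= D.
Proof.
apply: le_trans (sum_sqrt_le _ G0_ge0 G1_ge0) _.
rewrite -[leRHS]gtr0_norm // -sqrtr_sqr ler_wsqrtr // expr2.
have /andP[_ h0] := wD0 n; have /andP[_ h1] := wD1 n.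
by apply: ler_pM => //; exact: wsum_ge0.
Qed.

(** Cauchy-Schwarz over the fillings of the gap, then the upper gap inequality for each of the two
    weights. *)
Let affinity_gap m n :
  wsum affinity (m + (N + n)) <= D * (wsum affinity m * wsum affinity n).
Proof.
rewrite wsum_gap /wsum big_distrl big_distrr; apply: ler_sum => a _ /=.
rewrite !big_distrr; apply: ler_sum => b _ /=.
apply: le_trans (sum_sqrt_le _ _ _) _ => //.
have [_ _ _ u0] := GQ0; have [_ _ _ u1] := GQ1.
have h : (\sum_(x <- words A N) G0 (a ++ x ++ b)) * (\sum_(x <- words A N) G1 (a ++ x ++ b))
  <= (D * (G0 a * G0 b)) * (D * (G1 a * G1 b)) by apply: ler_pM => //; exact: sumr_ge0.
apply: le_trans (ler_wsqrtr h) _.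
rewrite (_ : _ * _ = D ^+ 2 * ((G0 a * G1 a) * (G0 b * G1 b))); last by ring.
by rewrite sqrtrM ?sqr_ge0 // sqrtr_sqr gtr0_norm // sqrtrM // mulr_ge0.
Qed.

(* Tilting [G0] by [2 ^ -h] and [G1] by [2 ^ h], with [h] the number of hits of [w], leaves
   the affinity unchanged, and Cauchy-Schwarz makes it decay unless [G0 w] is controlled
   by [G1 w]. *)
Lemma affinity_nondecaying_le w : (forall n, D^-1 <= wsum affinity n) ->
  G0 w <= 2 * D ^+ 10 * G1 w.
Proof.
move=> aD; pose k0 := expR (- (G0 w / (2 * D ^+ 5))); pose k1 := expR (D ^+ 5 * G1 w).
have half0 : (0 : R) <= 2^-1 by rewrite invr_ge0.
(* The tilted sums bound the squared affinity over [j] blocks by [(k0 * k1) ^+ j * D ^+ 2]. As the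
   affinity stays above [D^-1], the base is at least one, which compares the two exponents. *)
have kge : 1 <= k0 * k1.
  apply: (@exp_bounded_below_ge1 _ _ (D^-1 ^+ 2 / D ^+ 2)) => [||j].
  - by rewrite mulr_ge0 ?expR_ge0.
  - by rewrite divr_gt0 ?exprn_gt0 ?invr_gt0.
  rewrite ler_pdivrMr ?exprn_gt0 //.
  set L := (j * blk N w)%N.
  pose F0 u := 2^-1 ^+ hits N w j u * G0 u; pose F1 u := 2 ^+ hits N w j u * G1 u.
  have F0_ge0 u : 0 <= F0 u by rewrite mulr_ge0 ?exprn_ge0.
  have F1_ge0 u : 0 <= F1 u by rewrite mulr_ge0 ?exprn_ge0.
  have := aD L.
  have -> : wsum affinity L = \sum_(u <- words A L) Num.sqrt (F0 u * F1 u).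
    apply: eq_bigr => u _; congr Num.sqrt.
    by rewrite /F0 /F1 mulrACA -exprMn mulVf // expr1n mul1r.
  move/le_trans => /(_ _ (sum_sqrt_le _ F0_ge0 F1_ge0)) h.
  have S0 : \sum_(u <- words A L) F0 u <= k0 ^+ j * D.
    apply: le_trans (@sum_hits_le _ _ N w G0 2^-1 k0 j [::] half0 (expR_ge0 _)
      (sum_hit_half GQ0 wD0 w)) _.
    by rewrite ler_wpM2l ?exprn_ge0 ?expR_ge0 //; have /andP[] := wD0 L.
  have S1 : \sum_(u <- words A L) F1 u <= k1 ^+ j * D.
    apply: le_trans (@sum_hits_le _ _ N w G1 2 k1 j [::] (ler0n _ _) (expR_ge0 _)
      (sum_hit_double GQ1 wD1 w)) _.
    by rewrite ler_wpM2l ?exprn_ge0 ?expR_ge0 //; have /andP[] := wD1 L.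
  have S00 : 0 <= \sum_(u <- words A L) F0 u by exact: sumr_ge0.
  have S10 : 0 <= \sum_(u <- words A L) F1 u by exact: sumr_ge0.
  rewrite exprMn (_ : k0 ^+ j * k1 ^+ j * D ^+ 2 = (k0 ^+ j * D) * (k1 ^+ j * D)); last by ring.
  apply: le_trans (ler_pM S00 S10 S0 S1).
  rewrite -[leRHS]sqr_sqrtr ?mulr_ge0 //.
  by rewrite ler_pXn2r // ?nnegrE ?sqrtr_ge0 // invr_ge0 ltW.
move: kge; rewrite /k0 /k1 -expRD -expR0 ler_expR addrC subr_ge0.
rewrite ler_pdivrMr ?mulr_gt0 ?exprn_gt0 // => /le_trans; apply.
by rewrite le_eqVlt; apply/orP; left; apply/eqP; ring.
Qed.

(** Once the affinity is below [D^-1] at length [n], each further stretch of length [n + N]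
    contributes a factor [D * wsum affinity n], which is less than one. *)
Lemma affinity_exp_decay n : wsum affinity n < D^-1 ->
  exists C eta : R, [/\ 0 < C, 0 < eta &
    forall m, wsum affinity m <= C * expR (- (eta * m%:R))].
Proof.
move=> hn; have a0 w : 0 <= affinity w by exact: sqrtr_ge0.
(* The floor [1/2] keeps [rho] positive, so that it has a logarithm even if the affinity
   vanishes. *)
pose rho := Num.max (D * wsum affinity n) (1 / 2).
have rho0 : 0 < rho by rewrite lt_max; apply/orP; right; lra.
have rho1 : rho < 1.
  rewrite gt_max; apply/andP; split; last by lra.
  by rewrite -(mulfV (lt0r_neq0 D0)) ltr_pM2l.
pose q := (n + N)%N; have q0 : (0 < q)%N by rewrite addn_gt0 N0 orbT.
have qr0 : 0 < q%:R :> R by rewrite ltr0n.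
have iter j r : wsum affinity (j * q + r) <= rho ^+ j * D.
  elim: j r => [|j IH] r; first by rewrite expr0 mul1r mul0n.
  rewrite mulSn -addnA /q -addnA; apply: le_trans (affinity_gap _ _) _.
  rewrite mulrA exprS -(mulrA rho); apply: ler_pM => //.
  - by rewrite mulr_ge0 ?wsum_ge0 // ltW.
  - exact: wsum_ge0.
  - by rewrite le_max lexx.
(* The rate is spread over the [q] letters of a stretch; [rho^-1] pays for the incomplete last
   stretch. *)
exists (D * rho^-1), (- ln rho / q%:R); split.
- by rewrite mulr_gt0 ?invr_gt0.
- by rewrite divr_gt0 // oppr_gt0 ln_lt0 // rho0.
move=> m; rewrite {1}(divn_eq m q); apply: le_trans (iter _ _) _.
rewrite mulrC -mulrA ler_wpM2l ?(ltW D0) //.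
rewrite -{1 2}(@lnK _ rho) ?posrE // -expRN -expRM_natl -expRD ler_expR.
have ln0 : ln rho < 0 by rewrite ln_lt0 // rho0.
have : m%:R <= ((m %/ q)%:R + 1) * q%:R :> R.
  by rewrite natr1 -natrM ler_nat ltnW // ltn_ceil.
rewrite -ler_pdivrMr // => hm.
rewrite (_ : - ln rho / q%:R * m%:R = - ln rho * (m%:R / q%:R)); last by ring.
have := mulr_ge0 (ltW (_ : 0 < - ln rho)) (_ : 0 <= (m %/ q)%:R + 1 - m%:R / q%:R :> R).
rewrite oppr_gt0 subr_ge0 => /(_ ln0 hm); lra.
Qed.

(** In place of ergodicity: every stationary family dominated by a multiple of [G0] is at least
    [c * p1], with one [c] for all of them. Subtracting a share of [p1] from [p0] and renormalising
    gives such a family again, so the share of [p1] inside [p0] grows to one. *)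
Lemma stationary_dominated_eq p0 p1 K0 K1 C : stationary p0 -> stationary p1 ->
  (forall w, p0 w <= K0 * G0 w) -> (forall w, p1 w <= K1 * G1 w) ->
  (forall w, G1 w <= C * G0 w) -> p0 =1 p1.
Proof.
move=> ps0 ps1 pK0 pK1 GC.
have [p0_ge0 p0nil p0r p0l] := ps0; have [p1_ge0 p1nil p1r p1l] := ps1.
pose B := 2 * D ^+ 5; have B0 : 0 < B by rewrite mulr_gt0 ?exprn_gt0.
pose M := Num.max 1 (B * C).
have M1 : 1 <= M by rewrite le_max lexx.
have B1 : 1 <= B.
  have : 1 <= D ^+ 5 by exact: exprn_ege1.
  rewrite /B; lra.
have p1M w : p1 w <= M * G0 w.
  have [_ h] := uniform_gibbs GQ1 wD1 w ps1 pK1; apply: le_trans h _.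
  apply: (@le_trans _ _ (B * C * G0 w)); first by rewrite -/B -(mulrA B) ler_wpM2l // ltW.
  by rewrite ler_wpM2r // le_max lexx orbT.
(* The factor two keeps [c] strictly below one, so that the remainders [(1 - c) ^+ n] stay
   positive. *)
pose c := (2 * (B * M))^-1.
have BM1 : 1 <= B * M by rewrite mulr_ege1.
have c0 : 0 < c by rewrite invr_gt0; lra.
have c1 : c < 1 by rewrite invf_lt1; lra.
have step q w : stationary q -> (exists K, forall u, q u <= K * G0 u) -> c * p1 w <= q w.
  move=> qs [K qK]; have [h _] := uniform_gibbs GQ0 wD0 w qs qK.
  rewrite mulrC ler_pdivrMr; last by lra.
  apply: le_trans (p1M w) _; apply: le_trans (ler_wpM2l _ h) _; first by lra.
  have qw : 0 <= q w by case: qs.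
  have M0 : 0 <= M by lra.
  have : 0 <= M * (B * q w) by rewrite !mulr_ge0 // ltW.
  rewrite -/B; lra.
have key n w : (1 - (1 - c) ^+ n) * p1 w <= p0 w.
  elim: n w => [|n IH] w; first by rewrite expr0 subrr mul0r.
  set d := (1 - c) ^+ n in IH.
  have d0 : 0 < d by rewrite exprn_gt0 // subr_gt0.
  (* What is left of [p0], renormalised. Its domination constant [K0 / d] grows with [n], which is
     harmless because [step] does not depend on that constant. *)
  pose q u := (p0 u - (1 - d) * p1 u) / d.
  have qs : stationary q.
    split=> [u||u|u].
    - by rewrite divr_ge0 ?(ltW d0) // subr_ge0.
    - by rewrite /q p0nil p1nil mulr1 opprB addrC subrK mulfV ?lt0r_neq0.
    - by rewrite -big_distrl /= sumrB -big_distrr /= p0r p1r.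
    - by rewrite -big_distrl /= sumrB -big_distrr /= p0l p1l.
  have d1 : d <= 1 by apply: exprn_ile1; lra.
  have qK : exists K, forall u, q u <= K * G0 u.
    exists (K0 / d) => u; rewrite mulrAC ler_wpM2r ?invr_ge0 ?(ltW d0) //.
    apply: le_trans (pK0 u); rewrite gerBl mulr_ge0 //; lra.
  have := step q w qs qK; rewrite /q ler_pdivlMr // exprS -/d; lra.
have le10 w : p1 w <= p0 w.
  rewrite leNgt; apply/negP => lt; have p1w : 0 < p1 w := le_lt_trans (p0_ge0 w) lt.
  have : 1 <= 1 - c; last by lra.
  apply: (@exp_bounded_below_ge1 _ _ ((p1 w - p0 w) / p1 w)) => [||n]; first by lra.
    by rewrite divr_gt0 // subr_gt0.
  by rewrite ler_pdivrMr //; have := key n w; lra.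
(* Domination between two families of total mass one on each length is equality. *)
move=> w; apply/eqP; rewrite -subr_eq0; apply/eqP.
have := stationary_wsum (size w) ps0; rewrite -(stationary_wsum (size w) ps1).
move/eqP; rewrite -subr_eq0 -sumrB psumr_eq0 => [/allP/(_ w)|u _]; last by rewrite subr_ge0.
by rewrite mem_words eqxx => /(_ isT)/eqP.
Qed.

End Affinity.

(** * Equality or exponential decay of the affinity of two stationary families *)

Section Dichotomy.
Variables (A : finType) (R : realType) (N : nat) (D : R).
Variables G0 G1 : seq A -> R.

Lemma affinity_dichotomy p0 p1 K0 K1 : (0 < N)%N ->
  gapquasi N D G0 -> gapquasi N D G1 ->
  (forall n, D^-1 <= wsum G0 n <= D) -> (forall n, D^-1 <= wsum G1 n <= D) ->
  stationary p0 -> stationary p1 ->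
  (forall w, p0 w <= K0 * G0 w) -> (forall w, p1 w <= K1 * G1 w) ->
  p0 =1 p1 \/
  exists C eta : R, [/\ 0 < C, 0 < eta & forall m,
    \sum_(w <- words A m) Num.sqrt (p0 w * p1 w) <= C * expR (- (eta * m%:R))].
Proof.
move=> N0 GQ0 GQ1 wD0 wD1 ps0 ps1 pK0 pK1.
have [D1 G0_ge0 _ _] := GQ0; have [_ G1_ge0 _ _] := GQ1.
have D0 : 0 < D by lra.
have [[n hn]|h] := pselect (exists n, wsum (affinity G0 G1) n < D^-1); last first.
  (* The tilting argument bounds [G0] by [G1], so the rigidity lemma is applied with the two
     families exchanged. *)
  left; apply/fsym; apply: (stationary_dominated_eq GQ1 GQ0 wD1 wD0 ps1 ps0 pK1 pK0 (C := 2 * D ^+ 10)).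
  move=> w; apply: (affinity_nondecaying_le GQ0 GQ1 wD0 wD1) => n.
  by rewrite leNgt; apply/negP => hn; apply: h; exists n.
right; have [C [eta [C0 eta0 hC]]] := affinity_exp_decay N0 GQ0 GQ1 wD0 wD1 hn.
pose B := 2 * D ^+ 5; have B0 : 0 < B by rewrite mulr_gt0 ?exprn_gt0.
exists (B * C), eta; split => //; first by rewrite mulr_gt0.
move=> m; apply: (@le_trans _ _ (B * wsum (affinity G0 G1) m)); last first.
  by rewrite -mulrA ler_wpM2l // ltW.
rewrite /wsum big_distrr; apply: ler_sum => w _ /=.
have [_ h0] := uniform_gibbs GQ0 wD0 w ps0 pK0.
have [_ h1] := uniform_gibbs GQ1 wD1 w ps1 pK1.
have p00 : 0 <= p0 w by case: ps0.
have p10 : 0 <= p1 w by case: ps1.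
rewrite -(gtr0_norm B0) -sqrtr_sqr -sqrtrM ?sqr_ge0 // ler_wsqrtr //.
by have := ler_pM p00 p10 h0 h1; rewrite -/B; lra.
Qed.

End Dichotomy.

(** * Splicing in a shift of finite type and a uniform mixing gap *)

Section SubshiftGap.
Variables (A : finPointedType) (F : seq (seq A)).
Implicit Types (x y z : seqZ A) (u v w : seq A) (i j : int).

Local Notation Z := (SFT F).

Lemma size_word_at z i m : size (word_at z i m) = m.
Proof. by rewrite size_map size_iota. Qed.

Lemma nth_word_at a z i m k : (k < m)%N -> nth a (word_at z i m) k = z (i + k%:Z).
Proof. by move=> km; rewrite (nth_map 0%N) ?size_iota // nth_iota. Qed.

Lemma word_at_eqP x y i m :
  word_at x i m = word_at y i m <-> forall k, (k < m)%N -> x (i + k%:Z) = y (i + k%:Z).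
Proof.
split=> [e k km|h].
  by rewrite -(nth_word_at point x i km) e nth_word_at.
by apply/eq_in_map => k; rewrite mem_iota => /h.
Qed.

Definition translate i z : seqZ A := fun j => z (j + i).

Lemma word_at_translate i z j m : word_at (translate i z) j m = word_at z (j + i) m.
Proof. by apply: eq_map => k; rewrite /translate addrAC. Qed.

Lemma word_at_cat z i m n :
  word_at z i (m + n) = word_at z i m ++ word_at z (i + m%:Z) n.
Proof.
rewrite /word_at iotaD map_cat; congr (_ ++ _).
rewrite add0n -[in LHS](addn0 m) iotaDl -map_comp; apply: eq_map => k /=.
by rewrite PoszD addrA.
Qed.

Lemma SFT_translate i z : Z z -> Z (translate i z).
Proof. by move=> zZ j w wF; rewrite word_at_translate; exact: zZ. Qed.

Lemma occurs_at0 u : occurs Z u -> exists2 z, Z z & word_at z 0 (size u) = u.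
Proof.
move=> [z [i [zZ zu]]]; exists (translate i z); first exact: SFT_translate.
by rewrite word_at_translate add0r.
Qed.

Lemma word_at_occurs z i m : Z z -> occurs Z (word_at z i m).
Proof. by move=> zZ; exists z, i; rewrite size_word_at. Qed.

Lemma occurs_catl u v : occurs Z (u ++ v) -> occurs Z u.
Proof.
move=> /occurs_at0[z zZ]; rewrite size_cat word_at_cat => /eqP.
rewrite eqseq_cat ?size_word_at // => /andP[/eqP <- _].
exact: word_at_occurs.
Qed.

Lemma occurs_catr u v : occurs Z (u ++ v) -> occurs Z v.
Proof.
move=> /occurs_at0[z zZ]; rewrite size_cat word_at_cat => /eqP.
rewrite eqseq_cat ?size_word_at // => /andP[_ /eqP <-].
exact: word_at_occurs.
Qed.

Definition memory : nat := \max_(w <- F) size w.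

(** A forbidden word has length at most [memory], so a window of its size lies where the new point
    agrees with [x] if it starts before [i], and where it agrees with [y] otherwise. *)
Lemma SFT_glue x y i : Z x -> Z y ->
  (forall k, (k < memory)%N -> x (i + k%:Z) = y (i + k%:Z)) ->
  Z (fun j => if j < i + memory%:Z then x j else y j).
Proof.
move=> xZ yZ xy j w wF.
have wM : (size w <= memory)%N by exact: leq_bigmax_seq.
have [ji|ij] := ltP j i.
  have -> : word_at (fun j => if j < i + memory%:Z then x j else y j) j (size w) =
      word_at x j (size w); last exact: xZ.
  by apply/word_at_eqP => k kw; case: ltP => // h; exfalso; move: h kw wM ji; lia.
have -> : word_at (fun j => if j < i + memory%:Z then x j else y j) j (size w) =
    word_at y j (size w); last exact: yZ.
apply/word_at_eqP => k kw; case: ltP => // h.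
have := xy (absz (j + k%:Z - i)%R).
have -> : i + (absz (j + k%:Z - i)%R)%:Z = j + k%:Z by lia.
by apply; lia.
Qed.

Lemma occurs_glue u c v : size c = memory ->
  occurs Z (u ++ c) -> occurs Z (c ++ v) -> occurs Z (u ++ c ++ v).
Proof.
move=> cM /occurs_at0[x xZ xu] /occurs_at0[y yZ yv].
pose y' := translate (- (size u)%:Z) y; have y'Z : Z y' by exact: SFT_translate.
have y'v : word_at y' (size u)%:Z (size (c ++ v)) = c ++ v.
  by rewrite word_at_translate subrr.
move: xu y'v; rewrite !size_cat !word_at_cat => /eqP + /eqP.
rewrite !eqseq_cat ?size_word_at // => /andP[/eqP xu /eqP xc] /andP[/eqP yc /eqP y'v].
rewrite add0r in xc.
exists (fun j => if j < (size u)%:Z + memory%:Z then x j else y' j), 0; split.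
  apply: SFT_glue => //; apply/word_at_eqP; rewrite -cM; exact: etrans xc (esym yc).
rewrite !size_cat !word_at_cat add0r; congr (_ ++ (_ ++ _)).
- rewrite -[RHS]xu; apply/word_at_eqP => k ku; case: ltP => // h; exfalso; move: h ku; lia.
- rewrite -[RHS]xc; apply/word_at_eqP => k kc; case: ltP => // h; exfalso; move: h kc; lia.
- rewrite -[RHS]y'v; apply/word_at_eqP => k kv; case: ltP => // h; exfalso; move: h; lia.
Qed.

Lemma uniform_threshold (T : eqType) (s : seq T) (P : T -> nat -> Prop) :
  (forall t, exists N, forall m, (N <= m)%N -> P t m) ->
  exists N, forall t, t \in s -> forall m, (N <= m)%N -> P t m.
Proof.
move=> h; elim: s => [|t s [N IH]]; first by exists 0%N.
have [M tM] := h t; exists (maxn M N) => t'; rewrite inE => /orP[/eqP ->|t's] m.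
  by rewrite geq_max => /andP[Mm _]; exact: tM.
by rewrite geq_max => /andP[_ Nm]; exact: IH.
Qed.

(** Mixing gives a threshold for each pair of words. By splicing, only the last [memory] letters of
    [a] and the first [memory] letters of [b] matter, so finitely many pairs decide. *)
Lemma mixing_uniform_gap : mixing Z -> exists2 N, (0 < N)%N &
  forall a b, occurs Z a -> occurs Z b ->
    exists2 x, x \in words A N & occurs Z (a ++ x ++ b).
Proof.
move=> mix.
pose short := flatten [seq words A k | k <- iota 0 memory.+1].
have shortP u : (size u <= memory)%N -> u \in short.
  move=> uM; apply/flatten_mapP; exists (size u); first by rewrite mem_iota.
  by rewrite mem_words.
pose P (t : seq A * seq A) m := occurs Z t.1 -> occurs Z t.2 ->
  exists2 x, size x = m & occurs Z (t.1 ++ x ++ t.2).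
have [|N NP] := @uniform_threshold _ [seq (a, b) | a <- short, b <- short] P.
  move=> [a b]; have [[oa ob]|nab] := pselect (occurs Z a /\ occurs Z b).
    by have [N h] := mix _ _ oa ob; exists N => m /h[x [xm ox]] _ _; exists x.
  by exists 0%N => m _ oa ob; exfalso; apply: nab.
exists N.+1 => // a b oa ob.
(* The subtraction is truncated: for a short [a], [u] is empty and [c] is all of [a]. *)
pose u := take (size a - memory) a; pose c := drop (size a - memory) a.
pose d := take memory b; pose v := drop memory b.
have ea : u ++ c = a by exact: cat_take_drop.
have eb : d ++ v = b by exact: cat_take_drop.
have cd : (c, d) \in [seq (a, b) | a <- short, b <- short].
  apply/allpairsP; exists (c, d); split => //; apply: shortP.
    by rewrite size_drop; lia.
  by rewrite size_take; case: ltnP; lia.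
have [||x xN ox] := NP _ cd N.+1 (leqnSn _).
- by apply: (@occurs_catr u); rewrite ea.
- by apply: (@occurs_catl _ v); rewrite eb.
exists x; first by rewrite mem_words xN.
have oax : occurs Z (a ++ x ++ d).
  rewrite -ea -catA; have [aM|Ma] := leqP (size a) memory.
    have -> // : u = [::] by rewrite /u (eqP aM) take0.
  by apply: occurs_glue => //; [rewrite size_drop; lia | rewrite ea].
rewrite -eb; have [bM|Mb] := leqP (size b) memory.
  by have -> : v = [::] by [rewrite /v drop_oversize]; rewrite cats0.
rewrite !catA -catA; apply: occurs_glue; last by rewrite eb.
  by rewrite size_take Mb.
by rewrite -catA.
Qed.

End SubshiftGap.

(** * Birkhoff sums, weights of words and bounds uniform in the potential *)

Section Potentials.
Variables (A : finPointedType) (F : seq (seq A)) (R : realType).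
Implicit Types (x y z : seqZ A) (g : seqZ A -> R) (u v w : seq A) (b B P : R).

Local Notation Z := (SFT F).
Local Notation sh := (@Defs.shift A).

Lemma iter_shiftE k z m : iter k sh z m = z (m + k%:Z).
Proof.
elim: k m => [|k IH] m; first by rewrite addr0.
by rewrite iterS /Defs.shift IH -addrA -PoszD add1n.
Qed.

Lemma word_at_iter_shift k z i m : word_at (iter k sh z) i m = word_at z (i + k%:Z) m.
Proof. by apply: eq_map => j; rewrite iter_shiftE addrAC. Qed.

Lemma SFT_iter_shift k z : Z z -> Z (iter k sh z).
Proof. by move=> zZ i w wF; rewrite word_at_iter_shift; exact: zZ. Qed.

Definition birkhoff g n z : R := \sum_(k < n) g (iter k sh z).

Lemma birkhoffD g m n z :
  birkhoff g (m + n) z = birkhoff g m z + birkhoff g n (iter m sh z).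
Proof.
rewrite /birkhoff big_split_ord; congr (_ + _); apply: eq_bigr => k _ /=.
by rewrite addnC iterD.
Qed.

(** Hölder regularity in combinatorial form, with [q] standing for [2^-r]: points sharing the
    coordinates [|m| < n] are at distance at most [2^-n]. *)
Definition potential (q b : R) g : Prop :=
  (forall x, Z x -> `|g x| <= b) /\
  (forall x y n, Z x -> Z y -> (forall m : int, (absz m < n)%N -> x m = y m) ->
    `|g x - g y| <= b * q ^+ n).

Lemma birkhoff_le g b n z : (forall x, Z x -> `|g x| <= b) -> Z z ->
  `|birkhoff g n z| <= n%:R * b.
Proof.
move=> gb zZ; apply: le_trans (ler_norm_sum _ _ _) _.
apply: (@le_trans _ _ (\sum_(k < n) b)).
  by apply: ler_sum => k _; apply/gb/SFT_iter_shift.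
by rewrite sumr_const card_ord mulr_natl.
Qed.

(** Bounded distortion: after [k] shifts the points agree on all coordinates closer to the origin
    than [min (k + 1) (n - k)], so the errors are dominated by two geometric series, one from each
    end of the word. *)
Lemma birkhoff_distortion q b g n x y : 0 <= q < 1 -> 0 <= b -> potential q b g ->
  Z x -> Z y -> word_at x 0 n = word_at y 0 n ->
  `|birkhoff g n x - birkhoff g n y| <= 2 * b / (1 - q).
Proof.
move=> /andP[q0 q1] b0 [_ gH] xZ yZ /word_at_eqP xy.
have geom : \sum_(k < n) q ^+ k <= (1 - q)^-1.
  rewrite -[leRHS]mul1r ler_pdivlMr ?subr_gt0 //.
  have := subrX1 q n; set S := \sum_(i < n) _ => e.
  have := exprn_ge0 n q0; lra.
rewrite /birkhoff -sumrB; apply: le_trans (ler_norm_sum _ _ _) _.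
apply: (@le_trans _ _ (\sum_(k < n) (b * q ^+ k + b * q ^+ (n - k.+1)))).
  apply: ler_sum => k _.
  apply: (@le_trans _ _ (b * q ^+ (minn k.+1 (n - k)))).
    apply: gH; try exact: SFT_iter_shift.
    move=> m mk; rewrite !iter_shiftE.
    have := xy (absz (m + k%:Z)%R); have := ltn_ord k; rewrite add0r => kn.
    have -> : (absz (m + k%:Z)%R)%:Z = m + k%:Z by lia.
    by apply; lia.
  rewrite -mulrDr ler_wpM2l //; have := exprn_ge0 k q0; have := exprn_ge0 (n - k.+1) q0.
  have qk (i j : nat) : (i <= j)%N -> q ^+ j <= q ^+ i.
    by move=> ij; apply: ler_wiXn2l => //; rewrite ?q0 //= ltW.
  case: leqP => _; first by have := qk _ _ (leqnSn k); lra.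
  have := qk _ _ (leq_sub2l n (leqnSn k)); lra.
rewrite big_split /= -!big_distrr /=.
have -> : \sum_(j < n) q ^+ (n - j.+1) = \sum_(j < n) q ^+ j.
  rewrite (reindex_inj rev_ord_inj) /=; apply: eq_bigr => k _; congr (_ ^+ _).
  by have := ltn_ord k; lia.
have := ler_wpM2l b0 geom; lra.
Qed.

Definition rep w : seqZ A :=
  if pselect (exists2 z, Z z & word_at z 0 (size w) = w) is left h
  then s2val (cid2 h) else fun=> point.

Lemma repP w : occurs Z w -> Z (rep w) /\ word_at (rep w) 0 (size w) = w.
Proof.
move=> /occurs_at0 h; rewrite /rep; case: pselect => // h'.
by case: (cid2 h').
Qed.

Definition wexp g (P : R) n z : R := expR (- (n%:R * P) + birkhoff g n z).

(** The explicit weight is read at one chosen point of the cylinder, any other choice costing only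
    the distortion constant. The value zero off the language lets sums run over all words. *)
Definition wt g (P : R) w : R :=
  if `[< occurs Z w >] then wexp g P (size w) (rep w) else 0.

Lemma wt_ge0 g P w : 0 <= wt g P w.
Proof. by rewrite /wt; case: asboolP => // _; exact: expR_ge0. Qed.

Lemma wt_occurs g P w : occurs Z w -> wt g P w = wexp g P (size w) (rep w).
Proof. by rewrite /wt => /asboolP ->. Qed.

Lemma wt_not_occurs g P w : ~ occurs Z w -> wt g P w = 0.
Proof. by move=> no; rewrite /wt asboolF. Qed.

Lemma wexpD g P m n z : wexp g P (m + n) z = wexp g P m z * wexp g P n (iter m sh z).
Proof. by rewrite /wexp birkhoffD natrD -expRD; congr expR; ring. Qed.

Lemma wexp_bounds g P b B n z : (forall x, Z x -> `|g x| <= b) -> `|P| <= B -> Z z ->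
  wexp g P n z <= expR (n%:R * (b + B)) /\ 1 <= expR (n%:R * (b + B)) * wexp g P n z.
Proof.
move=> gb PB zZ; have := birkhoff_le n gb zZ; rewrite ler_norml => /andP[h1 h2].
move: PB; rewrite ler_norml => /andP[p1 p2].
have n0 : (0 : R) <= n%:R by [].
have q1 := ler_wpM2l n0 p1; have q2 := ler_wpM2l n0 p2.
split; first by rewrite ler_expR; lra.
by rewrite /wexp -expRD -[leLHS]expR0 ler_expR; lra.
Qed.

Section Quasi.
Variables (q b : R).
Hypotheses (q01 : 0 <= q < 1) (b0 : 0 <= b).
Let V := 2 * b / (1 - q).

Let V0 : 0 <= V.
Proof. by rewrite divr_ge0 ?mulr_ge0 // subr_ge0 ltW //; case/andP: q01. Qed.

Lemma wt_approx g P w z : potential q b g -> Z z -> word_at z 0 (size w) = w ->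
  wexp g P (size w) z <= expR V * wt g P w /\ wt g P w <= expR V * wexp g P (size w) z.
Proof.
move=> gp zZ zw; have ow : occurs Z w by exists z, 0.
have [rZ rw] := repP ow; rewrite wt_occurs // -!expRD !ler_expR.
have := birkhoff_distortion q01 b0 gp zZ rZ (etrans zw (esym rw)).
rewrite ler_norml -/V; lra.
Qed.

(** Along a single point the exponential weights factor exactly. Passing to [wt] for the outer words
    costs distortion, and the gap word is bounded crudely by its length. *)
Lemma wt_cat3 g P B (a x c : seq A) : potential q b g -> `|P| <= B -> occurs Z (a ++ x ++ c) ->
  let k := expR V * expR V * expR ((size x)%:R * (b + B)) in
  wt g P (a ++ x ++ c) <= k * (wt g P a * wt g P c) /\
  wt g P a * wt g P c <= k * wt g P (a ++ x ++ c).
Proof.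
move=> gp PB o; have [zZ zw] := repP o; rewrite wt_occurs //.
move: (rep _) zZ zw => z zZ; rewrite !size_cat !word_at_cat add0r => /eqP.
rewrite !eqseq_cat ?size_word_at // => /and3P[/eqP za /eqP zx /eqP zc].
rewrite !wexpD.
have [a1 a2] := wt_approx P gp zZ za.
set z1 := iter _ _ z; have z1Z : Z z1 by exact: SFT_iter_shift.
set z2 := iter _ _ z1; have z2Z : Z z2 by exact: SFT_iter_shift.
have z2c : word_at z2 0 (size c) = c.
  by rewrite !word_at_iter_shift add0r -PoszD -[RHS]zc -PoszD addnC.
have [c1 c2] := wt_approx P gp z2Z z2c.
have [x1 x2] := wexp_bounds (size x) gp.1 PB z1Z.
set Ea := wexp _ _ _ _ in a1 a2 *; set Ec := wexp _ _ _ z2 in c1 c2 *.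
set Ex := wexp _ _ _ _ in x1 x2 *.
have Ea0 : 0 <= Ea by exact: expR_ge0.
have Ec0 : 0 <= Ec by exact: expR_ge0.
have Ex0 : 0 <= Ex by exact: expR_ge0.
have Wa0 := wt_ge0 g P a; have Wc0 := wt_ge0 g P c.
set eV := expR V in a1 a2 c1 c2 *; set eN := expR _ in x1 x2 *.
have eV0 : 0 <= eV by exact: expR_ge0.
have eN0 : 0 <= eN by exact: expR_ge0.
split.
  have := ler_pM Ea0 (mulr_ge0 Ex0 Ec0) a1 (ler_pM Ex0 Ec0 x1 c1).
  by move/le_trans; apply; rewrite le_eqVlt; apply/orP; left; apply/eqP; ring.
have h := ler_pM Wa0 Wc0 a2 c2; apply: le_trans h _.
have := ler_wpM2l (mulr_ge0 (mulr_ge0 eV0 eV0) (mulr_ge0 Ea0 Ec0)) x2.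
rewrite mulr1; lra.
Qed.

(** The lower inequality uses the one filling provided by mixing; the upper one counts all
    [#|A| ^ N] fillings. *)
Lemma wt_gapquasi N g P B : potential q b g -> `|P| <= B ->
  (forall a c, occurs Z a -> occurs Z c ->
    exists2 x, x \in words A N & occurs Z (a ++ x ++ c)) ->
  gapquasi N ((#|A| ^ N)%:R * (expR V * expR V * expR (N%:R * (b + B)))) (wt g P).
Proof.
move=> gp PB gap; set k := expR V * _ * _.
have B0 : 0 <= B by apply: le_trans PB.
have k1 : 1 <= k.
  rewrite /k -!expRD -[leLHS]expR0 ler_expR; have := mulr_ge0 (ler0n R N) (addr_ge0 b0 B0).
  have := V0; lra.
have k0 : 0 <= k by lra.
have cA : (0 < #|A| ^ N)%N by rewrite expn_gt0; apply/orP; left; apply/card_gt0P; exists point.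
have cA1 : (1 : R) <= (#|A| ^ N)%:R by rewrite ler1n.
have kc : k <= (#|A| ^ N)%:R * k by rewrite ler_peMl.
split=> [|w|a c|a c].
- exact: le_trans kc.
- exact: wt_ge0.
- have [[oa oc]|no] := pselect (occurs Z a /\ occurs Z c); last first.
    have -> : wt g P a * wt g P c = 0.
      have [oa|na] := pselect (occurs Z a); last by rewrite wt_not_occurs ?mul0r.
      by rewrite mulrC wt_not_occurs ?mul0r // => oc; apply: no.
    by rewrite mulr_ge0 ?sumr_ge0 //; [lra|move=> *; exact: wt_ge0].
  have [x xN ox] := gap a c oa oc.
  have [_ h] := wt_cat3 gp PB ox; apply: le_trans h _.
  have -> : size x = N by move: xN; rewrite mem_words => /eqP.
  rewrite -/k; apply: ler_pM => //; first exact: wt_ge0.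
  rewrite (bigD1_seq x) ?uniq_words //= lerDl; apply: sumr_ge0 => *; exact: wt_ge0.
- apply: (@le_trans _ _ (\sum_(x <- words A N) k * (wt g P a * wt g P c))).
    rewrite big_seq [leRHS]big_seq; apply: ler_sum => x; rewrite mem_words => /eqP xN.
    have [ow|no] := pselect (occurs Z (a ++ x ++ c)).
      by have [+ _] := wt_cat3 gp PB ow; rewrite xN.
    by rewrite wt_not_occurs // !mulr_ge0 ?wt_ge0.
  by rewrite big_const_seq count_predT size_words iter_addr_0 -[leLHS]mulr_natl mulrA.
Qed.

End Quasi.

(* The weights [wt g P] are comparable to a stationary family [p], with constants that
   are allowed to depend on [g]. *)
Definition gibbs_words g P (p : seq A -> R) : Prop :=
  stationary p /\ exists2 K : R, 0 < K &
    forall w, p w <= K * wt g P w /\ wt g P w <= K * p w.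

Lemma gibbs_words_wsum g P p : gibbs_words g P p ->
  exists2 K : R, 0 < K & forall n, K^-1 <= wsum (wt g P) n <= K.
Proof.
move=> [ps [K K0 pK]]; exists K => // n; have p1 := stationary_wsum n ps.
apply/andP; split.
  rewrite -div1r ler_pdivrMr // mulrC -p1 /wsum big_distrr.
  by apply: ler_sum => w _; case: (pK w).
rewrite -[leRHS]mulr1 -p1 /wsum big_distrr.
by apply: ler_sum => w _; case: (pK w).
Qed.

(** The weight sums stay bounded: a single occurring word then bounds [P] from below, and the count
    [#|A| ^ n] of words bounds it from above. *)
Lemma gibbs_words_pressure g P p b : Z !=set0 -> (forall x, Z x -> `|g x| <= b) ->
  gibbs_words g P p -> `|P| <= b + ln (#|A|%:R).
Proof.
move=> [z zZ] gb /gibbs_words_wsum[K K0 sK].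
have cA : (0 < #|A|)%N by apply/card_gt0P; exists point.
have cA0 : (0 : R) < #|A|%:R by rewrite ltr0n.
have lA : 0 <= ln (#|A|%:R : R) by apply: ln_ge0; rewrite ler1n.
rewrite ler_norml; apply/andP; split.
  suff : - b - P <= 0 by lra.
  apply: (@bounded_expR_le0 _ _ K) => n.
  have /andP[_] := sK n; apply: le_trans.
  have ow := @word_at_occurs _ _ z 0 n zZ.
  rewrite /wsum (bigD1_seq (word_at z 0 n)) ?uniq_words ?mem_words ?size_word_at //=.
  rewrite ler_wpDr ?sumr_ge0 //; first by move=> *; exact: wt_ge0.
  rewrite wt_occurs // size_word_at ler_expR.
  have [rZ _] := repP ow; have := birkhoff_le n gb rZ; rewrite ler_norml; lra.
suff : 1 <= expR (b + ln #|A|%:R - P) by rewrite -[leLHS]expR0 ler_expR; lra.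
apply: (@exp_bounded_below_ge1 _ _ K^-1) => [||n]; first exact: expR_ge0.
  by rewrite invr_gt0.
have /andP[+ _] := sK n => /le_trans; apply.
apply: (@le_trans _ _ (\sum_(w <- words A n) expR (n%:R * (b - P)))).
  rewrite /wsum big_seq [leRHS]big_seq; apply: ler_sum => w; rewrite mem_words => /eqP wn.
  have [ow|no] := pselect (occurs Z w); last by rewrite wt_not_occurs ?expR_ge0.
  rewrite wt_occurs // wn ler_expR.
  have [rZ _] := repP ow; have := birkhoff_le n gb rZ; rewrite ler_norml; lra.
rewrite big_const_seq count_predT size_words iter_addr_0.
have -> : b + ln #|A|%:R - P = ln #|A|%:R + (b - P) by ring.
by rewrite expRD exprMn lnK ?posrE // -expRM_natl -natrX -[leLHS]mulr_natl.
Qed.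

Lemma gibbs_words_uniform q b : mixing Z -> Z !=set0 -> 0 <= q < 1 -> 0 <= b ->
  exists N, exists2 D : R, (0 < N)%N & forall g P p, potential q b g -> gibbs_words g P p ->
    gapquasi N D (wt g P) /\ forall n, D^-1 <= wsum (wt g P) n <= D.
Proof.
move=> mix Z0 q01 b0; have [N N0 gap] := mixing_uniform_gap mix.
(* [D] is left open here, before [g], [P] and [p] are introduced, and read off from [wt_gapquasi];
   it can depend only on [q], [b], [N] and the alphabet. *)
exists N; eexists; first exact: N0.
move=> g P p gp gw; have PB := gibbs_words_pressure Z0 gp.1 gw.
have GQ := wt_gapquasi q01 b0 gp PB gap.
split; first exact: GQ.
by have [K K0 sK] := gibbs_words_wsum gw; exact: gapquasi_wsum_bounds GQ K0 sK.
Qed.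

(** The weights on [n] letters change by a factor at most [exp (- n (P1 - P0 - e))]. Since both sums
    lie between [D^-1] and [D] for all [n], the exponent cannot tend to minus infinity. *)
Lemma pressure_le g0 g1 P0 P1 (D e : R) : 0 < D ->
  (forall n, D^-1 <= wsum (wt g0 P0) n <= D) ->
  (forall n, D^-1 <= wsum (wt g1 P1) n <= D) ->
  (forall x, Z x -> `|g1 x - g0 x| <= e) -> P1 <= P0 + e.
Proof.
move=> D0 w0 w1 ge.
suff : P1 - P0 - e <= 0 by lra.
apply: (@bounded_expR_le0 _ _ (D * D)) => n.
have /andP[l1 _] := w1 n; have /andP[_ u0] := w0 n.
have h : wsum (wt g1 P1) n <= expR (- (n%:R * (P1 - P0 - e))) * wsum (wt g0 P0) n.
  rewrite /wsum big_distrr big_seq [leRHS]big_seq; apply: ler_sum => w.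
  rewrite mem_words => /eqP wn /=.
  have [ow|no] := pselect (occurs Z w); last by rewrite !wt_not_occurs ?mulr0.
  rewrite !wt_occurs // wn /wexp -expRD ler_expR.
  have [rZ _] := repP ow.
  have : birkhoff g1 n (rep w) - birkhoff g0 n (rep w) <= n%:R * e.
    rewrite /birkhoff -sumrB -[n in n%:R]card_ord mulr_natl -sumr_const.
    apply: ler_sum => k _; apply: le_trans (ler_norm _) (ge _ _).
    exact: SFT_iter_shift.
  lra.
have := le_trans l1 (le_trans h (ler_wpM2l (expR_ge0 _) u0)).
rewrite expRN mulrC -div1r ler_pdivrMr //.
have E0 := expR_gt0 (n%:R * (P1 - P0 - e)).
by rewrite mulrAC ler_pdivlMr // mul1r.
Qed.

(** Both weights are read at the same representative. One [e] per letter comes from the Birkhoff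
    sums and one from the pressures; the constant is the square of that of [uniform_gibbs]. *)
Lemma gibbs_words_compare N D g0 g1 P0 P1 p0 p1 e :
  gibbs_words g0 P0 p0 -> gibbs_words g1 P1 p1 ->
  gapquasi N D (wt g0 P0) -> gapquasi N D (wt g1 P1) ->
  (forall n, D^-1 <= wsum (wt g0 P0) n <= D) ->
  (forall n, D^-1 <= wsum (wt g1 P1) n <= D) ->
  (forall x, Z x -> `|g1 x - g0 x| <= e) ->
  forall w, p1 w <= 4 * D ^+ 10 * expR (2 * e * (size w)%:R) * p0 w.
Proof.
move=> [ps0 [K0 K00 pK0]] [ps1 [K1 K10 pK1]] GQ0 GQ1 w0 w1 ge w.
have D0 : 0 < D by case: GQ0 => h _ _ _; lra.
have [h0 _] := uniform_gibbs GQ0 w0 w ps0 (fun u => (pK0 u).1).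
have [_ h1] := uniform_gibbs GQ1 w1 w ps1 (fun u => (pK1 u).1).
apply: le_trans h1 _.
have P01 : P0 <= P1 + e.
  by apply: (pressure_le D0 w1 w0) => x xZ; rewrite distrC; exact: ge.
have h : wt g1 P1 w <= expR (2 * e * (size w)%:R) * wt g0 P0 w.
  have [ow|no] := pselect (occurs Z w); last by rewrite !wt_not_occurs ?mulr0.
  rewrite !wt_occurs // /wexp -expRD ler_expR.
  have [rZ _] := repP ow; set n := size w.
  have : birkhoff g1 n (rep w) - birkhoff g0 n (rep w) <= n%:R * e.
    rewrite /birkhoff -sumrB -[n in n%:R]card_ord mulr_natl -sumr_const.
    apply: ler_sum => k _; apply: le_trans (ler_norm _) (ge _ _).
    exact: SFT_iter_shift.
  have := ler_wpM2l (ler0n R n) P01; lra.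
have c0 : 0 <= 2 * D ^+ 5 by rewrite mulr_ge0 ?exprn_ge0 ?(ltW D0).
apply: le_trans (ler_wpM2l c0 (le_trans h (ler_wpM2l (expR_ge0 _) h0))) _.
by rewrite le_eqVlt; apply/orP; left; apply/eqP; ring.
Qed.

End Potentials.

(** * Invariant measures, their word masses and the Gibbs property *)

Section WordMeasure.
Variables (A : finPointedType) (R : realType).
Implicit Types (z : seqZ A) (u w : seq A) (i : int).

Definition wset i u : set (seqM A) := [set z : seqZ A | word_at z i (size u) = u].

Lemma measurable_wset i u : measurable (wset i u).
Proof.
apply: sub_sigma_algebra; exists (fun j => nth point u (absz (j - i)%R)), i, (size u).
have e : word_at (fun j => nth point u (absz (j - i)%R)) i (size u) = u.
  apply: (@eq_from_nth _ point); rewrite size_word_at // => k ku.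
  by rewrite nth_word_at // addrAC subrr add0r.
by rewrite e.
Qed.

Lemma cyl_wset z m : cyl z m = wset 0 (word_at z 0 m).
Proof. by rewrite /cyl /wset size_word_at. Qed.

Lemma measurable_words i m (s : seq (seq A)) :
  measurable ([set z | word_at z i m \in s] : set (seqM A)).
Proof.
have -> : ([set z | word_at z i m \in s] : set (seqM A)) =
    \big[setU/set0]_(u <- [seq u <- s | size u == m]) wset i u.
  apply/seteqP; split => [z /= zs|z].
    rewrite -bigcup_seq; exists (word_at z i m) => /=.
      by rewrite mem_filter size_word_at eqxx.
    by rewrite /wset /= size_word_at.
  rewrite -bigcup_seq => -[u] /=; rewrite mem_filter => /andP[/eqP um us].
  by rewrite /wset /= um => ->.
by apply: bigsetU_measurable => u _; exact: measurable_wset.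
Qed.

Lemma measurable_SFT (F : seq (seq A)) : measurable (SFT F : set (seqM A)).
Proof.
have -> : (SFT F : set (seqM A)) = ~` \bigcup_(i : int)
    (\big[setU/set0]_(w <- F) wset i w).
  rewrite setC_bigcup; apply/seteqP; split => [z zF i _|z h i w wF].
    by rewrite -bigcup_seq => -[w /= wF] /eqP zw; move: (zF i w wF); rewrite zw.
  apply/eqP => zw; apply: (h i) => //; rewrite -bigcup_seq; by exists w.
apply: measurableC; apply: countable_bigcupT_measurable; first exact: countableP.
by move=> i; apply: bigsetU_measurable => w _; exact: measurable_wset.
Qed.

Section Mass.
Variable mu : probability (seqM A) R.
Hypothesis mu_shift : forall S : set (seqM A), measurable S ->
  mu (@Defs.shift A @^-1` S) = mu S.

Definition mass w : R := fine (mu (wset 0 w)).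

Lemma mu_wset0 w : mu (wset 0 w) = (mass w)%:E.
Proof. by rewrite /mass fineK // fin_num_measure //; exact: measurable_wset. Qed.

Lemma mu_wset i w : mu (wset i w) = (mass w)%:E.
Proof.
rewrite -mu_wset0.
have step j : mu (wset (j + 1) w) = mu (wset j w).
  rewrite -(mu_shift (measurable_wset j w)); congr (mu _).
  have -> // : wset (j + 1) w = @Defs.shift A @^-1` wset j w.
  apply/seteqP; split => z; rewrite /wset /preimage /=;
    have := word_at_iter_shift 1 z j (size w); by rewrite /= => ->.
elim/int_ind: i => // n IH; first by rewrite -IH -[RHS]step; congr (mu (wset _ _)); lia.
by rewrite -IH -[LHS]step; congr (mu (wset _ _)); lia.
Qed.

Lemma mu_words i m (s : seq (seq A)) : uniq s -> (forall w, w \in s -> size w = m) ->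
  mu ([set z | word_at z i m \in s] : set (seqM A)) = (\sum_(w <- s) mass w)%:E.
Proof.
move=> us sm.
have -> : ([set z | word_at z i m \in s] : set (seqM A)) = \bigcup_(w in [set` s]) wset i w.
  apply/seteqP; split => [z /= zs|z [w /= ws]].
    by exists (word_at z i m) => //=; rewrite /wset /= size_word_at.
  by rewrite /wset /= (sm _ ws) => ->.
rewrite measure_fin_bigcup; first last.
- by move=> w _; exact: measurable_wset.
- move=> u v /= us' vs [z []]; rewrite /wset /=.
  by rewrite (sm _ us') (sm _ vs) => -> ->.
- exact: finite_seq.
rewrite -fsbig_seq // -sumEFin; apply: eq_bigr => w _; exact: mu_wset.
Qed.

Lemma mass_stationary : stationary mass.
Proof.
split=> [w||w|w].
- exact: fine_ge0.
- rewrite /mass (_ : wset 0 [::] = setT) ?probability_setT //.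
  by apply/seteqP; split.
- apply: EFin_inj; rewrite -(mu_wset 0 w).
  rewrite -big_enum -(big_map (rcons w) xpredT mass) -(@mu_words 0 (size w).+1).
  + congr (mu _); apply/seteqP; split => z; rewrite /wset /= -[(size w).+1]addn1 word_at_cat.
      move=> /mapP[a _]; rewrite -cats1 => /eqP.
      by rewrite eqseq_cat ?size_word_at // => /andP[/eqP].
    move=> ->; apply/mapP; exists (z (0 + (size w)%:Z)); first by rewrite mem_enum.
    by rewrite -cats1 /word_at /= addr0.
  + by rewrite map_inj_uniq ?enum_uniq // => a b /rcons_inj[].
  + by move=> _ /mapP[a _ ->]; rewrite size_rcons.
- apply: EFin_inj; rewrite -(mu_wset 1 w).
  rewrite -big_enum -(big_map (cons^~ w) xpredT mass) -(@mu_words 0 (size w).+1).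
  + congr (mu _); apply/seteqP; split => z; rewrite /wset /= -[(size w).+1]add1n word_at_cat add0r.
      by move=> /mapP[a _] [_].
    move=> ->; apply/mapP; exists (z (0 + 0)); first by rewrite mem_enum.
    by [].
  + by rewrite map_inj_uniq ?enum_uniq // => a b [].
  + by move=> _ /mapP[a _ ->].
Qed.

End Mass.

(** Uniqueness of measures on a pi-system: words on centred windows, together with the empty set,
    are stable under intersection because the windows are nested, and invariance reduces their
    measure to a word mass at the origin. *)
Lemma mass_determines (mu nu : probability (seqM A) R) :
  (forall S : set (seqM A), measurable S -> mu (@Defs.shift A @^-1` S) = mu S) ->
  (forall S : set (seqM A), measurable S -> nu (@Defs.shift A @^-1` S) = nu S) ->
  mass mu =1 mass nu -> forall S : set (seqM A), measurable S -> mu S = nu S.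
Proof.
move=> muT nuT e.
pose G : set (set (seqM A)) := [set S | S = set0 \/
  exists (n : nat) u, S = [set z : seqZ A | word_at z (- n%:Z) (n + n) = u]].
pose win n u : set (seqM A) := [set z : seqZ A | word_at z (- n%:Z) (n + n) = u].
have win0 n u : size u != (n + n)%N -> win n u = set0.
  move=> us; apply/seteqP; split => // z /= zu; move: us.
  by rewrite -zu size_word_at eqxx.
have winE n u : size u = (n + n)%N -> win n u = wset (- n%:Z) u.
  by move=> us; rewrite /wset us.
have mwin n u : measurable (win n u).
  have [us|us] := eqVneq (size u) (n + n)%N; last by rewrite win0.
  by rewrite winE //; exact: measurable_wset.
have Gm : G `<=` measurable by move=> S [->|[n [u ->]]] //; exact: mwin.
have sub n z i m : (absz i <= n)%N -> (absz (i + m%:Z)%R <= n)%N -> forall y : seqZ A,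
    word_at y (- n%:Z) (n + n) = word_at z (- n%:Z) (n + n) -> word_at y i m = word_at z i m.
  move=> h1 h2 y /word_at_eqP yz; apply/word_at_eqP => k km.
  have := yz (absz (i + k%:Z + n%:Z)%R).
  have -> : - n%:Z + (absz (i + k%:Z + n%:Z)%R)%:Z = i + k%:Z by lia.
  by apply; lia.
have GI : setI_closed G.
  move=> S T [->|[n [u ->]]]; first by rewrite set0I; left.
  move=> [->|[m [v ->]]]; first by rewrite setI0; left.
  wlog nm : n u m v / (n <= m)%N.
    by move=> h; have [nm|/ltnW mn] := leqP n m; [exact: h|rewrite setIC; exact: h].
  have [[z [/= zu zv]]|no] := pselect (win n u `&` win m v !=set0); last first.
    left; apply/seteqP; split => // z zz; apply: no; by exists z.
  right; exists m, v; apply/seteqP; split => [y []//|y /= yv]; split => //=.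
  by rewrite -zu; apply: (sub m); rewrite ?zv ?yv //; lia.
have sG : @cylinders A `<=` <<s G >>.
  (* The window is chosen to contain both ends of the cylinder, which is then a finite union of
     window words. *)
  move=> _ [z [i [m ->]]]; pose n := (absz i + absz (i + m%:Z)%R)%N.
  pose good := [seq u <- words A (n + n) |
    `[< exists2 y : seqZ A, word_at y i m = word_at z i m & word_at y (- n%:Z) (n + n) = u >]].
  have -> : [set y : seqZ A | word_at y i m = word_at z i m] =
      \big[setU/set0]_(u <- good) win n u.
    rewrite -bigcup_seq; apply/seteqP; split => [y /= yz|y [u /=]].
      exists (word_at y (- n%:Z) (n + n)) => //=.
      rewrite mem_filter mem_words size_word_at eqxx andbT.
      by apply/asboolP; exists y.
    rewrite mem_filter => /andP[/asboolP[x xz <-] _] /= yx.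
    by rewrite -xz; apply: (sub n); rewrite // /n; lia.
  apply: (@bigsetU_measurable _ (g_sigma_algebraType G)) => u _.
  by apply: sub_sigma_algebra; right; exists n, u.
move=> S mS.
apply: (@g_sigma_algebra_measure_unique _ R _ G Gm (fun=> setT)) => //.
- by move=> _; right; exists 0%N, [::]; apply/seteqP; split.
- by rewrite bigcup_const.
- move=> T [->|[n [u ->]]]; first by rewrite !measure0.
  rewrite -/(win n u).
  have [us|us] := eqVneq (size u) (n + n)%N; last by rewrite win0 // !measure0.
  rewrite winE //; have := mu_wset nuT (- n%:Z) u; rewrite -e => h.
  exact: etrans (mu_wset muT (- n%:Z) u) (esym h).
- by move=> _; apply: (@le_lt_trans _ _ 1%E); [exact: probability_le1|exact: ltry].
- have : <<s @cylinders A >> S by exact: mS.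
  by apply: smallest_sub => //; exact: smallest_sigma_algebra.
Qed.

Section GibbsMass.
Variable F : seq (seq A).

(** The Gibbs inequalities cover nonempty occurring words. A word that does not occur has mass zero
    because [mu] is carried by the shift. *)
Lemma gibbs_gibbs_words g (mu : probability (seqM A) R) : gibbs (SFT F) g mu ->
  SFT F !=set0 /\ exists P, gibbs_words F g P (mass mu).
Proof.
move=> [muZ [muT [K [P [K0 h]]]]].
have Z0 : SFT F !=set0.
  apply/set0P/negP => /eqP Z0; move: muZ; rewrite Z0 measure0 => /eqP.
  by rewrite eqe eq_sym oner_eq0.
split => //; exists P; split; first exact: mass_stationary.
have [z zZ] := Z0; have nocc w : ~ occurs (SFT F) w -> mass mu w = 0.
  move=> no; have mZ := measurable_SFT F.
  have nuZ : mu (~` SFT F) = 0%E by rewrite probability_setC // muZ subee.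
  have : (mu (wset 0 w) <= mu (~` SFT F))%E.
    apply: le_measure; rewrite ?inE.
    - exact: measurable_wset.
    - exact: measurableC.
    by move=> y yw yZ; apply: no; exists y, 0.
  rewrite nuZ /mass => le0; have /eqP : mu (wset 0 w) == 0%E by rewrite eq_le le0 /=.
  by move=> ->.
(* The [1] serves the empty word, whose mass and weight are both one. *)
exists (Num.max 1 K); first by rewrite lt_max ltr01.
have K1 : 1 <= Num.max 1 K by rewrite le_max lexx.
have KK : K <= Num.max 1 K by rewrite le_max lexx orbT.
move=> w; have [ow|no] := pselect (occurs (SFT F) w); last first.
  by rewrite nocc // wt_not_occurs // mulr0.
have [->|w0] := eqVneq w [::].
  have [_ -> _ _] := mass_stationary muT.
  have on : occurs (SFT F) [::] by exists z, 0.
  by rewrite wt_occurs // /wexp /birkhoff big_ord0 /= mul0r oppr0 addr0 expR0 mulr1.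
have [rZ rw] := repP ow; rewrite wt_occurs //.
have m0 : (1 <= size w)%N by rewrite lt0n size_eq0.
have := h _ rZ _ m0; rewrite cyl_wset rw -/(mass mu w) -/(birkhoff _ _ _) -/(wexp _ _ _ _) /=.
have E0 : 0 < wexp g P (size w) (rep F w) by exact: expR_gt0.
have p0 : 0 <= mass mu w by exact: fine_ge0.
rewrite ler_pdivrMr // ler_pdivlMr // => -[lo up]; split.
  by apply: le_trans up _; rewrite ler_wpM2r // ltW.
apply: (@le_trans _ _ (K * mass mu w)); last by rewrite ler_wpM2r.
by move: lo; rewrite mulrC ler_pdivrMr // mulrC.
Qed.

Lemma dist_le x y n : (forall m : int, (absz m < n)%N -> x m = y m) ->
  @Defs.dist A R x y <= 2^-1 ^+ n.
Proof.
move=> xy; rewrite /Defs.dist; case: pselect => [h|_]; last by rewrite exprn_ge0 // invr_ge0.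
case: ex_minnP => m /orP d _.
apply: ler_wiXn2l; [by rewrite invr_ge0|by rewrite invf_le1 // ler1n|].
rewrite leqNgt; apply/negP => mn.
by case: d => /eqP; apply; apply: xy; lia.
Qed.

Lemma dist_gt0 x y : x <> y -> 0 < @Defs.dist A R x y.
Proof.
move=> xy; rewrite /Defs.dist; case: pselect => [h|no].
  by rewrite exprn_gt0 // invr_gt0.
exfalso; apply: xy; apply/funext => i; apply: contrapT => xi; apply: no.
exists (absz i); apply/orP.
have [i0|i0] := leP 0 i; [left|right]; apply/eqP.
  by have -> : (absz i)%:Z = i by lia.
by have -> : - (absz i)%:Z = i by lia.
Qed.

Lemma dist_ge0 x y : 0 <= @Defs.dist A R x y.
Proof.
have [->|/eqP/dist_gt0/ltW //] := eqVneq (x : int -> A) y.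
by rewrite /Defs.dist; case: pselect => // h; rewrite exprn_ge0 // invr_ge0.
Qed.

Lemma hnorm_potential (r b : R) (g : seqZ A -> R) : 0 < r -> (hnorm r (SFT F) g <= b%:E)%E ->
  potential F (powR 2^-1 r) b g.
Proof.
move=> r0; rewrite /hnorm; set s1 := ereal_sup _; set s2 := ereal_sup _ => hb.
(* The point [0] put into each supremum makes both parts of the norm nonnegative, so each is bounded
   by [b]. *)
have s10 : (0 <= s1)%E by apply: ereal_sup_ubound; left.
have s20 : (0 <= s2)%E by apply: ereal_sup_ubound; left.
have b1 : (s1 <= b%:E)%E by apply: le_trans hb; rewrite leeDl.
have b2 : (s2 <= b%:E)%E by apply: le_trans hb; rewrite leeDr.
have b0 : 0 <= b by rewrite -lee_fin; exact: le_trans b1.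
split=> [x xZ|x y n xZ yZ xy].
  by rewrite -lee_fin; apply: le_trans b1; apply: ereal_sup_ubound; right; exists x.
have [->|/eqP nxy] := eqVneq (x : int -> A) y.
  by rewrite subrr normr0 mulr_ge0 // exprn_ge0 // powR_ge0.
have d0 := dist_gt0 nxy.
have : `|g x - g y| / powR (Defs.dist R x y) r <= b.
  by rewrite -lee_fin; apply: le_trans b2; apply: ereal_sup_ubound; right; exists (x, y).
rewrite ler_pdivrMr ?powR_gt0 // => /le_trans; apply; rewrite ler_wpM2l //.
have h2 : (0 : R) <= 2^-1 by rewrite invr_ge0.
have -> : (powR 2^-1 r) ^+ n = powR (2^-1 ^+ n) r.
  by rewrite -powR_mulrn ?powR_ge0 // -powRrM mulrC powRrM powR_mulrn.
apply: ge0_ler_powR; rewrite ?nnegrE ?dist_ge0 ?exprn_ge0 ?(ltW r0) //.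
exact: dist_le.
Qed.

End GibbsMass.
End WordMeasure.

(** * Monotonicity of integrals of nonnegative functions *)

Section IntegralMonotone.
Local Open Scope ereal_scope.

(* The integral of a nonnegative function is a supremum over simple functions below it,
   so monotonicity needs no measurability. *)
Lemma ge0_le_integral_sup d (T : measurableType d) (R : realType) (m : {measure set T -> \bar R})
    (D : set T) (f1 f2 : T -> \bar R) : (forall x, D x -> 0 <= f1 x) ->
  (forall x, D x -> f1 x <= f2 x) -> \int[m]_(x in D) f1 x <= \int[m]_(x in D) f2 x.
Proof.
move=> f10 f12; have f20 x : D x -> 0 <= f2 x by move=> Dx; exact: le_trans (f10 x Dx) (f12 x Dx).
rewrite !ge0_integralE //; apply: le_ereal_sup => _ [h /= hf <-]; exists h => //= x.
apply: le_trans (hf x) _; rewrite /patch; case: ifPn => // /set_mem; exact: f12.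
Qed.

End IntegralMonotone.

(** * Almost sure decay of likelihood ratios *)

Section AlmostSureDecay.
Variables (A : finPointedType) (R : realType).
Implicit Types mu nu : probability (seqM A) R.

(** On a bad word, [mass mu w] is at most [exp (eta n / 2)] times the affinity term. The bad words
    of length [n] thus have [mu]-probability at most [C * exp (- eta n / 2)], which is summable, and
    Borel-Cantelli applies. *)
Lemma ae_mass_decay mu nu (C eta : R) :
  (forall S : set (seqM A), measurable S -> mu (@Defs.shift A @^-1` S) = mu S) ->
  0 < C -> 0 < eta ->
  (forall m, \sum_(w <- words A m) Num.sqrt (mass nu w * mass mu w) <=
     C * expR (- (eta * m%:R))) ->
  {ae mu, forall y : seqM A, exists n0, forall n, (n0 <= n)%N ->
    mass nu (word_at y 0 n) <= expR (- (eta * n%:R)) * mass mu (word_at y 0 n)}.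
Proof.
move=> muT C0 eta0 aff.
have p0 w : 0 <= mass mu w by exact: fine_ge0.
have q0 w : 0 <= mass nu w by exact: fine_ge0.
pose s n := [seq w <- words A n | expR (- (eta * n%:R)) * mass mu w < mass nu w].
pose B n : set (seqM A) := [set y | word_at y 0 n \in s n].
have mB n : measurable (B n) by exact: measurable_words.
pose rho := expR (- (eta / 2)).
have rho0 : 0 < rho by exact: expR_gt0.
have rho1 : rho < 1 by rewrite -[ltRHS]expR0 ltr_expR oppr_lt0 divr_gt0.
have muB n : (mu (B n) <= (geometric C rho n)%:E)%E.
  have -> : mu (B n) = (\sum_(w <- s n) mass mu w)%:E.
    apply: mu_words => //; first by rewrite filter_uniq ?uniq_words.
    by move=> w; rewrite mem_filter mem_words => /andP[_ /eqP].
  rewrite lee_fin big_filter /=.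
  apply: (@le_trans _ _ (\sum_(w <- words A n)
      expR (eta * n%:R / 2) * Num.sqrt (mass nu w * mass mu w))).
    rewrite big_mkcond; apply: ler_sum => w _; case: ifP => h; last first.
      by rewrite mulr_ge0 ?expR_ge0 ?sqrtr_ge0.
    have e : expR (eta * n%:R) = expR (eta * n%:R / 2) ^+ 2.
      by rewrite expr2 -expRD; congr expR; lra.
    rewrite -[expR _]ger0_norm ?expR_ge0 // -sqrtr_sqr -sqrtrM ?sqr_ge0 // -e.
    rewrite -[leLHS]ger0_norm // -sqrtr_sqr ler_wsqrtr // expr2 mulrA ler_wpM2r //.
    rewrite -ler_pdivrMl ?expR_gt0 // -expRN; exact: ltW.
  rewrite -big_distrr /=; apply: le_trans (ler_wpM2l (expR_ge0 _) (aff n)) _.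
  rewrite /geometric /= mulrCA -expRD /rho -expRM_natl.
  by rewrite ler_wpM2l ?(ltW C0) // ler_expR; lra.
have l0 : mu (lim_sup_set B) = 0%E.
  apply: lim_sup_set_cvg0 => //.
  apply: (@le_lt_trans _ _ (\sum_(0 <= n <oo) (geometric C rho n)%:E)%E).
    by apply: lee_nneseries => [n _ _|n _]; [exact: measure_ge0|exact: muB].
  apply: (@le_lt_trans _ _ (C / (1 - rho))%:E); last exact: ltry.
  apply: lime_le.
    by apply: is_cvg_nneseries => n _ _; rewrite lee_fin mulr_ge0 ?exprn_ge0 // ltW.
  apply: nearW => n; rewrite sumEFin lee_fin.
  have := @geometric_le_lim R n C rho (ltW C0) rho0.
  by rewrite ger0_norm ?(ltW rho0) //; apply.
exists (lim_sup_set B); split => //.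
  apply: bigcap_measurable => // k _; exact: bigcup_measurable.
move=> y /= ny n _; apply: contrapT => nB; apply: ny; exists n => k nk.
rewrite leNgt; apply/negP => h; apply: nB; exists k => //=.
by rewrite /B /s /= mem_filter h mem_words size_word_at eqxx.
Qed.

End AlmostSureDecay.

(** * Regular families, domination off the true parameter and the posterior *)

Section Family.
Variables (R : realType) (A : finPointedType) (F : seq (seq A)).
Variables (Th : pseudoPMetricType R) (f : Th -> seqZ A -> R).
Variable mu : Th -> probability (seqM A) R.
Hypotheses (mix : mixing (SFT F)) (reg : regular_family (SFT F) f).
Hypothesis gib : forall t, gibbs (SFT F) (f t) (mu t).

Local Notation p t := (mass (mu t)).

Let muT t (S : set (seqM A)) : measurable S -> mu t (@Defs.shift A @^-1` S) = mu t S.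
Proof. by have [_ [+ _]] := gib t; apply. Qed.

Let Z0 (t : Th) : SFT F !=set0. Proof. by case: (gibbs_gibbs_words (gib t)). Qed.

Lemma potential_le q b b' (g : seqZ A -> R) : 0 <= q -> b <= b' ->
  potential F q b g -> potential F q b' g.
Proof.
move=> q0 bb [g1 g2]; split=> [x xZ|x y n xZ yZ xy]; first exact: le_trans (g1 x xZ) bb.
by apply: le_trans (g2 x y n xZ yZ xy) _; rewrite ler_wpM2r ?exprn_ge0.
Qed.

Lemma potentialD q b e (g h : seqZ A -> R) : potential F q b g ->
  potential F q e (fun x => h x - g x) -> potential F q (b + e) h.
Proof.
move=> [g1 g2] [h1 h2]; split=> [x xZ|x y n xZ yZ xy].
  have -> : h x = g x + (h x - g x) by ring.
  by apply: le_trans (ler_normD _ _) _; rewrite lerD ?g1 // h1.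
have -> : h x - h y = (g x - g y) + ((h x - g x) - (h y - g y)) by ring.
by apply: le_trans (ler_normD _ _) _; rewrite mulrDl lerD ?g2 // h2.
Qed.

Let reg_potential : exists q, 0 <= q < 1 /\
  (forall t, exists2 b, 0 <= b & potential F q b (f t)) /\
  forall t (e : R), 0 < e -> \forall t' \near t, potential F q e (fun x => f t' x - f t x).
Proof.
have [r [r0 [hf cf]]] := reg; exists (powR 2^-1 r); split; [|split].
- rewrite powR_ge0 /= -[ltRHS](powRr0 2^-1) /powR.
  rewrite !ifF; try by apply/negbTE; rewrite invr_neq0.
  rewrite ltr_expR mul0r pmulr_rlt0 // ln_lt0 // invr_gt0 ltr0n /=.
  by rewrite invf_lt1 // ltr1n.
- move=> t; have := hf t; rewrite /Defs.hoelder.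
  have : (0 <= hnorm r (SFT F) (f t))%E.
    by rewrite /hnorm adde_ge0 //; apply: ereal_sup_ubound; left.
  case E : (hnorm r (SFT F) (f t)) => [b||] // b0 _.
  by exists b => //; apply: hnorm_potential => //; rewrite E.
- move=> t e e0; apply: filterS (cf t e e0) => t' h.
  by apply: hnorm_potential => //; exact: ltW.
Qed.

(** Potentials within [e] of [f t0] share the bound [b + e], so a single [D] serves a whole
    neighbourhood, and the comparison of nearby potentials runs both ways. *)
Lemma local_mass_compare t0 e : 0 < e -> exists2 C, 0 < C & \forall t \near t0, forall w,
  p t w <= C * expR (2 * e * (size w)%:R) * p t0 w /\
  p t0 w <= C * expR (2 * e * (size w)%:R) * p t w.
Proof.
move=> e0; have [q [q01 [pot cont]]] := reg_potential; have /andP[q0 _] := q01.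
have [b b0 fb] := pot t0.
have b10 : 0 <= b + e by rewrite addr_ge0 // ltW.
have [N [D N0 unif]] := gibbs_words_uniform mix (Z0 t0) q01 b10.
have fb0 : potential F q (b + e) (f t0) by apply: potential_le fb => //; rewrite lerDl ltW.
have [_ [P0 gw0]] := gibbs_gibbs_words (gib t0).
have [GQ0 w0] := unif _ _ _ fb0 gw0.
have D1 : 1 <= D by case: GQ0.
exists (4 * D ^+ 10); first by rewrite mulr_gt0 // exprn_gt0 //; lra.
apply: filterS (cont t0 e e0) => t ft w.
have [_ [P1 gw1]] := gibbs_gibbs_words (gib t).
have [GQ1 w1] := unif _ _ _ (potentialD fb ft) gw1.
split; first exact: gibbs_words_compare gw0 gw1 GQ0 GQ1 w0 w1 ft.1 w.
apply: gibbs_words_compare gw1 gw0 GQ1 GQ0 w1 w0 _ w => x xZ.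
by rewrite distrC; exact: ft.1.
Qed.

Lemma mass_affinity_dichotomy t0 t1 : p t0 =1 p t1 \/
  exists C eta : R, [/\ 0 < C, 0 < eta & forall m,
    \sum_(w <- words A m) Num.sqrt (p t0 w * p t1 w) <= C * expR (- (eta * m%:R))].
Proof.
have [q [q01 [pot _]]] := reg_potential; have /andP[q0 _] := q01.
have [b0 b00 f0] := pot t0; have [b1 b10 f1] := pot t1.
have b01 : 0 <= b0 + b1 by rewrite addr_ge0.
have [N [D N0 unif]] := gibbs_words_uniform mix (Z0 t0) q01 b01.
have {}f0 : potential F q (b0 + b1) (f t0) by apply: potential_le f0 => //; rewrite lerDl.
have {}f1 : potential F q (b0 + b1) (f t1) by apply: potential_le f1 => //; rewrite lerDr.
have [_ [P0 gw0]] := gibbs_gibbs_words (gib t0).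
have [_ [P1 gw1]] := gibbs_gibbs_words (gib t1).
have [GQ0 w0] := unif _ _ _ f0 gw0; have [GQ1 w1] := unif _ _ _ f1 gw1.
have [ps0 [K0 _ pK0]] := gw0; have [ps1 [K1 _ pK1]] := gw1.
exact: (affinity_dichotomy N0 GQ0 GQ1 w0 w1 ps0 ps1 (fun w => (pK0 w).1) (fun w => (pK1 w).1)).
Qed.

Variable tstar : Th.

(** The quantifier over [t] stands inside the almost sure event: one null set and one [n0] serve all
    of [S], so the bound can be integrated over [S]. *)
Definition exp_dominated (S : set Th) : Prop := exists C eta : R, [/\ 0 < C, 0 < eta &
  {ae mu tstar, forall y : seqM A, exists n0, forall n, (n0 <= n)%N -> forall t, S t ->
    p t (word_at y 0 n) <= C * expR (- (eta * n%:R)) * p tstar (word_at y 0 n)}].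

Lemma exp_dominated_sub S T : S `<=` T -> exp_dominated T -> exp_dominated S.
Proof.
move=> ST [C [eta [C0 eta0 h]]]; exists C, eta; split => //.
by apply: filterS h => y [n0 h]; exists n0 => n n0n t St; apply: h => //; exact: ST.
Qed.

Lemma exp_dominatedU S T : exp_dominated S -> exp_dominated T -> exp_dominated (S `|` T).
Proof.
move=> [C [eta [C0 eta0 hS]]] [C' [eta' [C'0 eta'0 hT]]].
exists (C + C'), (Num.min eta eta'); split; [exact: addr_gt0|by rewrite lt_min eta0|].
apply: filterS2 hS hT => y [n0 h] [n1 h']; exists (maxn n0 n1) => n.
rewrite geq_max => /andP[nn0 nn1] t.
have pt : 0 <= p tstar (word_at y 0 n) by exact: fine_ge0.
have n_ge0 : (0 : R) <= n%:R by [].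
case=> [/(h n nn0 t)|/(h' n nn1 t)] => /le_trans; apply; apply: ler_wpM2r => //;
  apply: ler_pM; rewrite ?expR_ge0 ?(ltW C0) ?(ltW C'0) ?lerDl ?lerDr ?(ltW C0) ?(ltW C'0) //;
  by rewrite ler_expR lerN2 ler_wpM2r // ge_min lexx ?orbT.
Qed.

Lemma exp_dominated_seq (s : seq (set Th)) : (forall V, V \in s -> exp_dominated V) ->
  exp_dominated (\bigcup_(V in [set` s]) V).
Proof.
elim: s => [_|V s IH h].
  by exists 1, 1; split => //; apply: nearW => y; exists 0%N => n _ t [].
apply: (@exp_dominated_sub _ (V `|` \bigcup_(W in [set` s]) W)).
  move=> t [W /=]; rewrite inE => /orP[/eqP -> Vt|Ws Wt]; [by left|by right; exists W].
apply: exp_dominatedU; first by apply: h; rewrite mem_head.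
by apply: IH => W Ws; apply: h; rewrite inE Ws orbT.
Qed.

Lemma exp_dominated_near t0 : ~ (p t0 =1 p tstar) ->
  exists2 V, open_nbhs t0 V & exp_dominated V.
Proof.
move=> ne; have [//|[C [eta [C0 eta0 aff]]]] := mass_affinity_dichotomy t0 tstar.
(* Moving from [t0] to a nearby parameter costs [exp (2 * (eta / 4) * n)], half of the rate. *)
have e0 : 0 < eta / 4 by rewrite divr_gt0.
have [C1 C10] := local_mass_compare t0 e0; rewrite /prop_near1 nbhsE => -[V Vt0 VC].
exists V => //; exists C1, (eta / 2); split => //; first by rewrite divr_gt0.
apply: filterS (ae_mass_decay (@muT tstar) C0 eta0 aff) => y [n0 h].
exists n0 => n n0n t Vt; have [+ _] := VC t Vt (word_at y 0 n) => /le_trans; apply.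
rewrite size_word_at -(mulrA C1) -(mulrA C1) ler_wpM2l ?(ltW C10) //.
apply: le_trans (ler_wpM2l (expR_ge0 _) (h n n0n)) _.
rewrite mulrA -expRD ler_wpM2r ?fine_ge0 // ler_expR; lra.
Qed.

(** Relative to the mass of the observed word under [tstar], the numerator is at most
    [C * exp (- eta n)] and the denominator at least a constant times [exp (- eta n / 2)]. The
    common mass cancels and a geometric bound remains. *)
Lemma posterior_cvg0 (Pi0 : probability (borelM Th) R) (U : set Th) :
  compact [set: Th] -> (forall V : set Th, open V -> V !=set0 -> (0 < Pi0 V)%E) -> open U ->
  [set t | p t =1 p tstar] `<=` U ->
  {ae mu tstar, forall y : seqM A, (fun n => posterior Pi0 mu n (~` U) y) @ \oo --> 0}.
Proof.
move=> cpt full oU sU.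
have [C [eta [C0 eta0 dom]]] : exp_dominated (~` U).
  have cU : compact (~` U).
    by apply: (@subclosed_compact _ _ setT) => //; exact: open_closedC.
  rewrite compact_cover in cU.
  have [V oV|t tU|E EV Ucov] := cU _ [set V | open V /\ exp_dominated V] id.
  - by case: oV.
  - have nt : ~ (p t =1 p tstar) by move=> /sU.
    by have [V [oV Vt] dV] := exp_dominated_near nt; exists V.
  apply: exp_dominated_sub Ucov _; apply: exp_dominated_seq => V /EV.
  by rewrite inE => -[].
(* With this closeness the denominator loses only rate [eta / 2], against [eta] in the numerator. *)
have e0 : 0 < eta / 4 by rewrite divr_gt0.
have [C1 C10] := local_mass_compare tstar e0; rewrite /prop_near1 nbhsE => -[V [oV Vt] VC].
have mopen (W : set Th) : open W -> measurable (W : set (borelM Th)).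
  by move=> oW; apply: sub_sigma_algebra.
have PV : (0 < Pi0 V)%E by apply: full => //; exists tstar.
have PVfin : Pi0 V \is a fin_num by rewrite fin_num_measure //; exact: mopen.
pose v := fine (Pi0 V); have v0 : 0 < v by rewrite fine_gt0 // PV ltey_eq PVfin.
pose rho := expR (- (eta / 2)); pose k := C * C1 / v.
have rho0 : 0 < rho by exact: expR_gt0.
have rho1 : rho < 1 by rewrite -[ltRHS]expR0 ltr_expR oppr_lt0 divr_gt0.
have k0 : 0 <= k by rewrite divr_ge0 ?mulr_ge0 ?ltW.
apply: filterS dom => y [n0 dom].
apply: (@squeeze_cvgr _ _ _ _ (cst 0) (geometric k rho)); last 2 first.
- exact: cvg_cst.
- by apply: cvg_geometric; rewrite ger0_norm // ltW.
exists n0 => // n /= n0n; set w := word_at y 0 n.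
have pw : 0 <= p tstar w by exact: fine_ge0.
have mE t : mu t (cyl y n) = (p t w)%:E by rewrite cyl_wset mu_wset0.
rewrite /posterior; set I1 := (\int[_]_(_ in _) _)%E; set I2 := (\int[_]_(_ in _) _)%E.
have I10 : (0 <= I1)%E by apply: integral_ge0.
have I20 : (0 <= I2)%E by apply: integral_ge0.
pose c := C * expR (- (eta * n%:R)) * p tstar w.
have c0 : 0 <= c by rewrite !mulr_ge0 ?expR_ge0 ?(ltW C0).
have I1c : (I1 <= c%:E)%E.
  apply: (@le_trans _ _ (\int[Pi0]_(t in (~` U : set (borelM Th))) (cst c%:E t))%E).
    apply: ge0_le_integral_sup => t /= Ut; first exact: measure_ge0.
    by rewrite mE lee_fin; exact: dom.
  rewrite integral_cst; last by apply: measurableC; exact: mopen.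
  rewrite -[leRHS]mule1 lee_wpmul2l ?lee_fin //; apply: probability_le1.
  by apply: measurableC; exact: mopen.
have I21 : (I2 <= 1)%E.
  apply: (@le_trans _ _ (\int[Pi0]_(t in [set: borelM Th]) (cst 1%E t))%E).
    apply: ge0_le_integral_sup => t _; first exact: measure_ge0.
    by rewrite cyl_wset; apply: probability_le1; exact: measurable_wset.
  by rewrite integral_cst // mul1e probability_le1.
pose d := C1^-1 * expR (- (eta / 2 * n%:R)) * p tstar w.
have d0 : 0 <= d by rewrite !mulr_ge0 ?expR_ge0 ?invr_ge0 ?(ltW C10).
(* The constant [d] on [V], extended by zero, lies below the integrand. *)
have I2d : (d%:E * Pi0 V <= I2)%E.
  rewrite -integral_cst; last exact: mopen.
  rewrite integral_mkcond; apply: ge0_le_integral_sup => t _; rewrite /patch.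
    by case: ifPn => // _; rewrite lee_fin.
  case: ifPn => [Vt'|_]; last exact: measure_ge0.
  rewrite mE lee_fin /d -mulrA ler_pdivrMl // expRN mulrC ler_pdivrMr ?expR_gt0 //.
  have [_] := VC t (set_mem Vt') w; rewrite size_word_at => /le_trans; apply.
  by rewrite mulrAC ler_wpM2l ?mulr_ge0 ?(ltW C10) ?fine_ge0 // ler_expR; lra.
have fin1 : I1 \is a fin_num by rewrite ge0_fin_numE // (le_lt_trans I1c) ?ltry.
have fin2 : I2 \is a fin_num by rewrite ge0_fin_numE // (le_lt_trans I21) ?ltry.
have {}I1c : fine I1 <= c by rewrite -lee_fin fineK.
have {}I2d : d * v <= fine I2 by rewrite -lee_fin fineK // EFinM /v fineK.
have f1 : 0 <= fine I1 by exact: fine_ge0.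
have f2 : 0 <= fine I2 by exact: fine_ge0.
rewrite divr_ge0 //=.
have key : fine I1 <= k * rho ^+ n * fine I2.
  apply: le_trans I1c _.
  have kr0 : 0 <= k * rho ^+ n by rewrite mulr_ge0 // exprn_ge0 // ltW.
  apply: le_trans (ler_wpM2l kr0 I2d).
  have e : expR (- (eta * n%:R)) = rho ^+ n * expR (- (eta / 2 * n%:R)).
    by rewrite /rho -expRM_natl -expRD; congr expR; lra.
  rewrite /c e /k /d le_eqVlt; apply/orP; left; apply/eqP.
  by field; rewrite !lt0r_neq0.
(* If the denominator vanishes, the quotient is zero by the convention on inverses. *)
have [z|nz] := eqVneq (fine I2) 0.
  by rewrite z invr0 mulr0 mulr_ge0 // exprn_ge0 // ltW.
by rewrite ler_pdivrMr // lt_neqAle eq_sym nz.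
Qed.

End Family.

Theorem theorem2p1 (R : realType) (A : finPointedType) (F : seq (seq A))
  (Th : pseudoPMetricType R)
  (f : Th -> seqZ A -> R) (mu : Th -> probability (seqM A) R)
  (Pi0 : probability (borelM Th) R) (tstar : Th) :
  mixing (SFT F) ->
  hausdorff_space Th -> compact [set: Th] ->
  regular_family (SFT F) f ->
  (forall t, gibbs (SFT F) (f t) (mu t)) ->
  (forall V : set Th, open V -> V !=set0 -> (0 < Pi0 V)%E) ->
  forall U : set Th, open U ->
    [set t | forall S : set (seqM A), measurable S -> mu t S = mu tstar S] `<=` U ->
    {ae mu tstar, forall y : seqM A,
       (fun n => posterior Pi0 mu n (~` U) y) @ \oo --> 0}.
Proof.
move=> mix _ cpt reg gib full U oU sU.
(* [posterior_cvg0] identifies parameters through word masses; it remains to see that equal word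
   masses give equal measures. *)
apply: (posterior_cvg0 mix reg gib cpt full oU) => t tE; apply: sU => S mS.
have muT t' (S' : set (seqM A)) : measurable S' -> mu t' (@Defs.shift A @^-1` S') = mu t' S'.
  by have [_ [+ _]] := gib t'; apply.
exact: (mass_determines (@muT t) (@muT tstar) tE).
Qed.
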